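(* Let $M^3$ be a Lagrangian submanifold of the homogeneous nearly Kähler sphere $\mathbb S^6(1)$. Then, at every point, the tensors $P$ and $A$ satisfy $$|P|^2+3\sum_{i,j,k}P_{ijk}P_{jik}\ge\tfrac9{40}|\nabla s|^2-\tfrac13|A|^2 .$$
   Context: Everything is smooth. Identify $\mathbb R^7$ with the imaginary Cayley numbers with cross product $X\times Y=\tfrac12(XY-YX)$. The homogeneous nearly Kähler structure on $\mathbb S^6(1)\subset\mathbb R^7$ is the round metric $\langle\cdot,\cdot\rangle$ with $J_xX=x\times X$. Let $\overline\nabla$ be its Levi-Civita connection and $G(X,Y)=(\overline\nabla_XJ)Y$. A Lagrangian submanifold is an immersed 3-manifold $M^3$ with the induced metric such that $J(TM)=T^\perp M$. Let $\nabla,\nabla^\perp$ be the Levi-Civita and normal connections, $h(X,Y)=\overline\nabla_XY-\nabla_XY$ the second fundamental form, and $A_\xi$ the shape operator, $\langle A_\xi X,Y\rangle=\langle h(X,Y),\xi\rangle$. It is known that $M$ is orientable and minimal and that $G(X,Y)$ is normal for tangent $X,Y$. The form $\omega(X,Y,Z)=\langle G(X,Y),JZ\rangle$ is the volume form of $M$ for a suitable orientation, which is fixed. In a local oriented orthonormal frame $\{e_1,e_2,e_3\}$: $\omega_{ijk}=\omega(e_i,e_j,e_k)$ (so $\omega_{123}=1$); $h_{ijk}=\langle h(e_i,e_j),Je_k\rangle$ (known to be totally symmetric and trace-free); $s=|h|^2=\sum_{i,j,k}h_{ijk}^2$. Set $(\nabla h)(X,Y,Z)=\nabla^\perp_Xh(Y,Z)-h(\nabla_XY,Z)-h(Y,\nabla_XZ)$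 and $$T(X,Y,Z)=(\nabla h)(X,Y,Z)-\tfrac14\{G(X,A_{JZ}Y)+G(Y,A_{JX}Z)+G(Z,A_{JY}X)\},$$ $T_{lijk}=\langle T(e_l,e_i,e_j),Je_k\rangle$ (a totally symmetric trace-free tensor). Define $$P_{ijk}=\sum_{a,b}h_{abi}T_{abjk},\quad W_{ij}=\sum_{a,b}\omega_{iab}P_{abj},\quad A_{ij}=\tfrac12(W_{ij}+W_{ji}),$$ with $|P|^2=\sum_{i,j,k} P_{ijk}^2$, $|A|^2=\sum_{i,j}A_{ij}^2$. (The matrix $A=(A_{ij})$ is not to be confused with the shape operator $A_\xi$.) *)

(* Defs.v *)
(* MathComp / MathComp-Analysis development *)
From HB Require Import structures.
From mathcomp Require Import all_boot all_order all_algebra.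
From mathcomp Require Import all_classical all_reals all_analysis.
Set Implicit Arguments.
Unset Strict Implicit.
Unset Printing Implicit Defensive.
Import Order.TTheory GRing.Theory Num.Theory.
Import numFieldNormedType.Exports.

Local Open Scope classical_set_scope.
Local Open Scope ring_scope.

(** * Cayley numbers and the cross product of R^7 *)

(* One step of the Cayley-Dickson process:
   (a, b)(c, d) = (a c - conj d b, d a + b conj c), conj (a, b) = (conj a, - b).
   Three steps starting from R give C, H and the Cayley numbers. *)
Definition cd_mul (A : zmodType) (mul : A -> A -> A) (conj : A -> A)
    (x y : A * A) : A * A :=
  (mul x.1 y.1 - mul (conj y.2) x.2, mul y.2 x.1 + mul x.2 (conj y.1)).

Definition cd_conj (A : zmodType) (conj : A -> A) (x : A * A) : A * A :=
  (conj x.1, - x.2).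

Definition cayley (R : realType) : lmodType R :=
  ((R^o * R^o) * (R^o * R^o) * ((R^o * R^o) * (R^o * R^o)))%type.

Definition cayley_mul (R : realType) : cayley R -> cayley R -> cayley R :=
  let conj0 := fun x : R^o => x in
  let mul0 := fun x y : R^o => (x * y : R^o) in
  let mul1 := cd_mul mul0 conj0 in
  let conj1 := cd_conj conj0 in
  let mul2 := cd_mul mul1 conj1 in
  let conj2 := cd_conj conj1 in
  cd_mul mul2 conj2.

Definition cayley_of_im (R : realType) (x : 'rV[R]_7) : cayley R :=
  let c k : R^o := x 0 (inord k) in
  (((0, c 0%N), (c 1%N, c 2%N)), ((c 3%N, c 4%N), (c 5%N, c 6%N))).

Definition im_of_cayley (R : realType) (z : cayley R) : 'rV[R]_7 :=
  \row_i nth 0 [:: z.1.1.2; z.1.2.1; z.1.2.2; z.2.1.1; z.2.1.2; z.2.2.1;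
                   z.2.2.2] i.

(* X x Y = (XY - YX) / 2; the real part of a commutator vanishes, so that
   im_of_cayley loses no information here. *)
Definition cross (R : realType) (x y : 'rV[R]_7) : 'rV[R]_7 :=
  let X := cayley_of_im x in
  let Y := cayley_of_im y in
  im_of_cayley (2^-1 *: (cayley_mul X Y - cayley_mul Y X)).

(** * Calculus on open subsets of R^n *)

Definition dot (R : realType) (n : nat) (u v : 'rV[R]_n) : R :=
  \sum_(i < n) u 0 i * v 0 i.

Definition evec (R : realType) (n : nat) (i : 'I_n) : 'rV[R]_n :=
  delta_mx 0 i.

Fixpoint iter_pderiv (R : realType) (m n : nat) (s : seq 'I_m.+1)
    (f : 'rV[R]_m.+1 -> 'rV[R]_n.+1) : 'rV[R]_m.+1 -> 'rV[R]_n.+1 :=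
  if s is i :: s' then fun x => 'D_(evec R i) (iter_pderiv s' f) x else f.

(* C^infinity: all iterated partial derivatives exist on D and are (Frechet)
   differentiable, hence continuous, there. Meant for D open. *)
Definition smooth_on (R : realType) (m n : nat) (D : set 'rV[R]_m.+1)
    (f : 'rV[R]_m.+1 -> 'rV[R]_n.+1) : Prop :=
  forall (s : seq 'I_m.+1) x, D x -> differentiable (iter_pderiv s f) x.

(** * Smooth 3-manifolds *)

Record chart (R : realType) (M : topologicalType) := Chart {
  chart_dom : set M;
  chart_map : M -> 'rV[R]_3;
  chart_inv : 'rV[R]_3 -> M }.

Definition chart_img (R : realType) (M : topologicalType) (c : chart R M) :
    set 'rV[R]_3 :=
  chart_map c @` chart_dom c.

Record is_chart (R : realType) (M : topologicalType) (c : chart R M) : Prop := {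
  chart_dom_open : open (chart_dom c);
  chart_img_open : open (chart_img c);
  chart_mapK : forall p, chart_dom c p -> chart_inv c (chart_map c p) = p;
  chart_map_cont : {within chart_dom c, continuous (chart_map c)};
  chart_inv_cont : {within chart_img c, continuous (chart_inv c)} }.

Record smooth_manifold (R : realType) (M : topologicalType)
    (atlas : set (chart R M)) : Prop := {
  manifold_hausdorff : hausdorff_space M;
  manifold_countable : @second_countable M;
  atlas_chart : forall c, atlas c -> is_chart c;
  atlas_cover : forall p : M, exists2 c, atlas c & chart_dom c p;
  atlas_compat : forall c d, atlas c -> atlas d ->
    smooth_on (chart_map c @` (chart_dom c `&` chart_dom d))
              (chart_map d \o chart_inv c) }.

(** * Geometry of an immersion f of an open subset of R^3 into S^6

   Tangent vector fields are given by their coordinates X : 'rV_3 -> 'rV_3, the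
   corresponding R^7-valued field being df(X) = push f X; fields along f that
   are tangent to S^6 (in particular normal fields) are maps V : 'rV_3 -> 'rV_7.
   All operators are local in the base point u. *)

Section Immersion.
Variables (R : realType) (f : 'rV[R]_3 -> 'rV[R]_7).

Definition tfield := 'rV[R]_3 -> 'rV[R]_3.
Definition afield := 'rV[R]_3 -> 'rV[R]_7.

Definition push (X : tfield) : afield := fun u => 'D_(X u) f u.

Definition dcoord (i : 'I_3) : tfield := fun=> evec R i.

Definition metric (u : 'rV[R]_3) : 'M[R]_3 :=
  \matrix_(i, j) dot (push (dcoord i) u) (push (dcoord j) u).

Definition christoffel (u : 'rV[R]_3) (k i j : 'I_3) : R :=
  2^-1 * \sum_l invmx (metric u) k l *
    ('D_(evec R i) (fun v => metric v j l) u
     + 'D_(evec R j) (fun v => metric v i l) u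
     - 'D_(evec R l) (fun v => metric v i j) u).

(* Levi-Civita connection of the induced metric *)
Definition nabla (X Y : tfield) : tfield := fun u =>
  \row_k ('D_(X u) (fun v => Y v 0 k) u
          + \sum_i \sum_j christoffel u k i j * X u 0 i * Y u 0 j).

(* Levi-Civita connection of the round sphere, for fields along f: the part
   tangent to S^6 of the derivative in R^7 (f u is the unit normal of S^6). *)
Definition nablabar (X : tfield) (V : afield) : afield := fun u =>
  'D_(X u) V u - dot ('D_(X u) V u) (f u) *: f u.

Definition Jop (V : afield) : afield := fun u => cross (f u) (V u).

(* (nablabar_X J) V *)
Definition nablabarJ (X : tfield) (V : afield) : afield :=
  nablabar X (Jop V) - Jop (nablabar X V).

Definition Gop (X Y : tfield) : afield := nablabarJ X (push Y).

(* second fundamental form *)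
Definition sff (X Y : tfield) : afield :=
  nablabar X (push Y) - push (nabla X Y).

(* coordinates of the tangential part of V *)
Definition tangent_part (V : afield) : tfield := fun u =>
  \row_k \sum_l invmx (metric u) k l * dot (V u) (push (dcoord l) u).

Definition normal_part (V : afield) : afield := V - push (tangent_part V).

Definition nablaperp (X : tfield) (xi : afield) : afield :=
  normal_part (nablabar X xi).

(* the tangent field with <shape xi X, Y> = <sff X Y, xi> for all Y *)
Definition shape (xi : afield) (X : tfield) : tfield := fun u =>
  \row_k \sum_l invmx (metric u) k l * dot (sff X (dcoord l) u) (xi u).

Definition nablah (X Y Z : tfield) : afield :=
  nablaperp X (sff Y Z) - sff (nabla X Y) Z - sff Y (nabla X Z).

Definition Tten (X Y Z : tfield) : afield :=
  nablah X Y Z - 4^-1 *: (Gop X (shape (Jop (push Z)) Y)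
                          + Gop Y (shape (Jop (push X)) Z)
                          + Gop Z (shape (Jop (push Y)) X)).

Definition omega (X Y Z : tfield) (u : 'rV[R]_3) : R :=
  dot (Gop X Y u) (Jop (push Z) u).

Definition grad (s : 'rV[R]_3 -> R) : tfield := fun u =>
  \row_k \sum_l invmx (metric u) k l * 'D_(evec R l) s u.

Definition grad_sqnorm (s : 'rV[R]_3 -> R) (u : 'rV[R]_3) : R :=
  dot (push (grad s) u) (push (grad s) u).

(* The orientation is the one for which omega is a positive 3-form. *)
Definition oriented_orthonormal_frame (V : set 'rV[R]_3) (e : 'I_3 -> tfield) :
    Prop :=
  [/\ forall i, smooth_on V (e i),
      forall u, V u -> forall i j,
        dot (push (e i) u) (push (e j) u) = (i == j)%:R
    & forall u, V u ->
        0 < omega (e (inord 0)) (e (inord 1)) (e (inord 2)) u].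

Section Frame.
Variable e : 'I_3 -> tfield.

Definition hf (i j k : 'I_3) (u : 'rV[R]_3) : R :=
  dot (sff (e i) (e j) u) (Jop (push (e k)) u).

Definition omegaf (i j k : 'I_3) (u : 'rV[R]_3) : R :=
  omega (e i) (e j) (e k) u.

Definition Tf (l i j k : 'I_3) (u : 'rV[R]_3) : R :=
  dot (Tten (e l) (e i) (e j) u) (Jop (push (e k)) u).

Definition h_sqnorm (u : 'rV[R]_3) : R :=
  \sum_i \sum_j \sum_k hf i j k u ^+ 2.

Definition Pf (i j k : 'I_3) (u : 'rV[R]_3) : R :=
  \sum_a \sum_b hf a b i u * Tf a b j k u.

Definition Wf (i j : 'I_3) (u : 'rV[R]_3) : R :=
  \sum_a \sum_b omegaf i a b u * Pf a b j u.

Definition Af (i j : 'I_3) (u : 'rV[R]_3) : R := 2^-1 * (Wf i j u + Wf j i u).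

Definition P_sqnorm (u : 'rV[R]_3) : R :=
  \sum_i \sum_j \sum_k Pf i j k u ^+ 2.

Definition A_sqnorm (u : 'rV[R]_3) : R := \sum_i \sum_j Af i j u ^+ 2.

End Frame.
End Immersion.

(** * Lagrangian immersions into S^6 *)

Definition immersion_on (R : realType) (U : set 'rV[R]_3)
    (f : 'rV[R]_3 -> 'rV[R]_7) : Prop :=
  smooth_on U f /\ forall u, U u -> injective (fun v => 'D_v f u).

(* J maps each tangent space onto the normal space in T S^6 *)
Definition lagrangian_on (R : realType) (U : set 'rV[R]_3)
    (f : 'rV[R]_3 -> 'rV[R]_7) : Prop :=
  forall u, U u ->
    [set cross (f u) ('D_v f u) | v in setT] =
    [set w | dot w (f u) = 0 /\ forall v, dot w ('D_v f u) = 0].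

Record lagrangian_immersion (R : realType) (M : topologicalType)
    (atlas : set (chart R M)) (F : M -> 'rV[R]_7) : Prop := {
  lagrangian_sphere : forall p, dot (F p) (F p) = 1;
  lagrangian_immersed : forall c, atlas c ->
    immersion_on (chart_img c) (F \o chart_inv c);
  lagrangian_normal : forall c, atlas c ->
    lagrangian_on (chart_img c) (F \o chart_inv c) }.

(* Main.v *)
(* The left-hand side minus the right-hand side is 4 |S|^2, where S is the
   totally symmetric trace-free part of P: as an O(3)-module, the tensors P that
   are symmetric and trace-free in the last two indices split into three
   irreducible components, of dimensions 7, 5 and 3, and the coefficients 1/3
   and 9/40 of |A|^2 and |grad s|^2 are those for which the last two components
   cancel. This needs P to be trace-free and symmetric in its last two indices
   and the identity sum_i P_iil = (1/2) e_l(s), hence the total symmetry and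
   tracelessness of T. These come from differentiating, along the frame, the
   orthonormality relations of the basis (f, E_i, N_i = f x E_i) of R^7, where
   E_i = df(e_i): they give the symmetry of h and the fact that E_i x E_j is
   normal; the derivative of the latter gives minimality, and the commutation
   D_X D_Y - D_Y D_X = D_[X,Y] applied to E_j gives the Codazzi equation. *)
Require Import Defs.
From HB Require Import structures.
From mathcomp Require Import all_boot all_order all_algebra.
From mathcomp Require Import all_classical all_reals all_analysis.
From mathcomp Require Import ring lra.
Set Implicit Arguments.
Unset Strict Implicit.
Unset Printing Implicit Defensive.
Import Order.TTheory GRing.Theory Num.Theory.
Import numFieldNormedType.Exports.
Local Open Scope classical_set_scope.
Local Open Scope ring_scope.

(** * Tensors on a three-dimensional space *)

Lemma sum3 (A : nmodType) (F : 'I_3 -> A) :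
  \sum_i F i = F (inord 0) + F (inord 1) + F (inord 2).
Proof.
rewrite !big_ord_recl big_ord0 addr0 addrA.
by congr (F _ + F _ + F _); apply/val_inj; rewrite /= inordK.
Qed.

Lemma ord3_ind (P : 'I_3 -> Prop) :
  P (inord 0) -> P (inord 1) -> P (inord 2) -> forall i, P i.
Proof.
move=> P0 P1 P2 i; rewrite -(inord_val i).
by case: i => -[|[|[|i]]] // ?.
Qed.

Lemma ord3_eqE : let o i : 'I_3 := inord i in
  ((o 0 == o 1) = false) * ((o 0 == o 2) = false) * ((o 1 == o 2) = false) *
  ((o 1 == o 0) = false) * ((o 2 == o 0) = false) * ((o 2 == o 1) = false).
Proof. by do !split; rewrite -val_eqE /= !inordK. Qed.

Section Tensors.
Variable R : realFieldType.
Implicit Types (w h : 'I_3 -> 'I_3 -> 'I_3 -> R).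

Local Notation o0 := (inord 0 : 'I_3).
Local Notation o1 := (inord 1 : 'I_3).
Local Notation o2 := (inord 2 : 'I_3).

Definition volume_form w :=
  [/\ forall i j k, w j i k = - w i j k, forall i j k, w i k j = - w i j k
    & w o0 o1 o2 = 1].

Lemma volume_formE w : volume_form w ->
  ((forall i k, w i i k = 0) * (forall i k, w k i i = 0) * (forall i k, w i k i = 0)) *
  ((w o0 o1 o2 = 1) * (w o1 o2 o0 = 1) * (w o2 o0 o1 = 1)) *
  ((w o0 o2 o1 = -1) * (w o1 o0 o2 = -1) * (w o2 o1 o0 = -1)).
Proof.
move=> [w1 w2 w3].
have z1 i k : w i i k = 0 by have := w1 i i k; lra.
have z2 i k : w k i i = 0 by have := w2 k i i; lra.
have z3 i k : w i k i = 0 by have := w2 i k i; rewrite z1; lra.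
have a1 := w1 o0 o1 o2; have a2 := w2 o0 o1 o2; have a3 := w1 o0 o2 o1.
have a4 := w2 o1 o0 o2; have a5 := w1 o1 o2 o0.
by do !split => //; lra.
Qed.

Lemma sum_sq_decomposition w (P : 'I_3 -> 'I_3 -> 'I_3 -> R) :
  volume_form w -> (forall i j k, P i k j = P i j k) ->
  (forall i, \sum_j P i j j = 0) ->
  \sum_i \sum_j \sum_k P i j k ^+ 2 + 3 * (\sum_i \sum_j \sum_k P i j k * P j i k)
  >= 9 / 10 * (\sum_l (\sum_i P i i l) ^+ 2)
    - 1 / 3 * (\sum_i \sum_j (2^-1 * (\sum_a \sum_b w i a b * P a b j
                                    + \sum_a \sum_b w j a b * P a b i)) ^+ 2).
Proof.
move=> /volume_formE wE Psym Ptr.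
pose t l := \sum_i P i i l.
pose S i j k := (P i j k + P j k i + P k i j) / 3
  - 2 / 15 * ((i == j)%:R * t k + (j == k)%:R * t i + (i == k)%:R * t j).
rewrite -subr_ge0 [leRHS](_ : _ = 4 * \sum_i \sum_j \sum_k S i j k ^+ 2); last first.
  have T i : P i o2 o2 = - P i o0 o0 - P i o1 o1 by have := Ptr i; rewrite sum3; lra.
  rewrite /S /t !sum3 !wE !eqxx !ord3_eqE /= !T.
  have s10 i : P i o1 o0 = P i o0 o1 by rewrite Psym.
  have s20 i : P i o2 o0 = P i o0 o2 by rewrite Psym.
  have s21 i : P i o2 o1 = P i o1 o2 by rewrite Psym.
  rewrite !s10 !s20 !s21.
  by field.
apply: mulr_ge0 => //; apply: sumr_ge0 => i _; apply: sumr_ge0 => j _.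
by apply: sumr_ge0 => k _; exact: sqr_ge0.
Qed.

Lemma swap_cyclic_eq0 (h p : 'I_3 -> 'I_3 -> 'I_3 -> R) :
  (forall i j k, h j i k = h i j k) -> (forall i j k, h i k j = h i j k + p j i k) ->
  (forall i j k, p k i j = p i j k) -> forall i j k, p i j k = 0.
Proof.
move=> h12 hp pC i j k.
have s1 := hp j i k; have s2 := hp i k j; have s3 := hp k j i.
have := pC i j k; have := pC j k i; have := h12 i j k; have := h12 j k i.
have := h12 i k j; lra.
Qed.

Lemma cubic_trace w h : volume_form w ->
  (forall i j k, h j i k = h i j k) -> (forall i j k, h i k j = h i j k) ->
  (forall l i j m, \sum_k w j m k * h l i k + \sum_k w m i k * h l j k
    + \sum_k w i j k * h l m k = 0) -> forall l, \sum_i h l i i = 0.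
Proof.
move=> wE h12 h23 H l; have := H l o0 o1 o2; rewrite !sum3 !(volume_formE wE); lra.
Qed.

Section CubicForms.
Variables (w h : 'I_3 -> 'I_3 -> 'I_3 -> R) (G : 'I_3 -> 'I_3 -> 'I_3 -> R).
Variables (d T : 'I_3 -> 'I_3 -> 'I_3 -> 'I_3 -> R).
Hypotheses (wE : volume_form w).
Hypotheses (h12 : forall i j k, h j i k = h i j k)
  (h23 : forall i j k, h i k j = h i j k) (htr : forall k, \sum_i h i i k = 0).
Hypotheses (d12 : forall l i j k, d l j i k = d l i j k)
  (d23 : forall l i j k, d l i k j = d l i j k)
  (dtr : forall l k, \sum_i d l i i k = 0).
Hypothesis GN : forall l i j, G l j i = - G l i j.

Let dh l i j k := d l i j k - \sum_m h i j m * (w l k m + G l k m)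
  - \sum_a G l i a * h a j k - \sum_a G l j a * h i a k.

Hypothesis codazzi : forall l i j k, dh l i j k = dh i l j k.
Hypothesis TE : forall l i j k, T l i j k = dh l i j k
  - 4^-1 * (\sum_a h i a j * w l a k + \sum_a h j a l * w i a k
            + \sum_a h l a i * w j a k).

Let h_normal : (forall k, h o1 o0 k = h o0 o1 k) * (forall k, h o2 o0 k = h o0 o2 k)
  * (forall k, h o2 o1 k = h o1 o2 k) * (forall k, h k o1 o0 = h k o0 o1)
  * (forall k, h k o2 o0 = h k o0 o2) * (forall k, h k o2 o1 = h k o1 o2).
Proof. by do !split => *; first [exact: h12 | exact: h23]. Qed.

Let h_trace : (h o0 o2 o2 = - h o0 o0 o0 - h o0 o1 o1)
  * (h o1 o2 o2 = - h o0 o0 o1 - h o1 o1 o1) * (h o2 o2 o2 = - h o0 o0 o2 - h o1 o1 o2).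
Proof.
by do !split; [have := htr o0|have := htr o1|have := htr o2];
  rewrite sum3 ?h_normal; lra.
Qed.

Let G_normal : (forall l, G l o1 o0 = - G l o0 o1) * (forall l, G l o2 o0 = - G l o0 o2)
  * (forall l, G l o2 o1 = - G l o1 o2) * (forall l i, G l i i = 0).
Proof.
have G0 l i : G l i i = 0 by have := GN l i i; lra.
by do !split => // l; exact: GN.
Qed.

Let h13 i j k : h k j i = h i j k.
Proof. by rewrite h12 h23 h12. Qed.

Lemma T_sym12 l i j k : T i l j k = T l i j k.
Proof.
rewrite !TE codazzi; congr (_ - _ * _); rewrite [in RHS](addrC (\sum_a _)).
by congr (_ + _ + _); apply: eq_bigr => a _; rewrite h13.
Qed.

Lemma T_sym23 l i j k : T l j i k = T l i j k.
Proof.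
rewrite !TE; congr (_ - _ * _); last first.
  by rewrite addrAC; congr (_ + _ + _); apply: eq_bigr => a _; rewrite h13.
rewrite /dh d12 addrAC; congr (_ - _ - _ - _); apply: eq_bigr => a _; rewrite ?(h12 a)//.
by rewrite h12.
Qed.

Lemma T_sym34 l i j k : T l i k j = T l i j k.
Proof.
apply/eqP; rewrite -subr_eq0; apply/eqP; rewrite !TE /dh d23.
rewrite !sum3.
move: l i j k; elim/ord3_ind; elim/ord3_ind; elim/ord3_ind; elim/ord3_ind;
  rewrite ?(volume_formE wE) ?h_normal ?h_trace ?G_normal.
all: by field.
Qed.

Lemma T_trace l i : \sum_k T l i k k = 0.
Proof.
have dT m k : d m k o2 o2 = - d m k o0 o0 - d m k o1 o1.
  have E a : d m k a a = d m a a k by rewrite -d12 -d23.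
  by have := dtr m k; rewrite sum3 !E; lra.
rewrite sum3 !TE /dh !sum3.
move: l i; elim/ord3_ind; elim/ord3_ind;
  rewrite ?(volume_formE wE) ?h_normal ?h_trace ?G_normal ?dT.
all: by field.
Qed.

Lemma contract_T l :
  \sum_i \sum_j \sum_k h i j k * T l i j k = \sum_i \sum_j \sum_k h i j k * d l i j k.
Proof.
rewrite !sum3 !TE /dh !sum3.
move: l; elim/ord3_ind;
  rewrite ?(volume_formE wE) ?h_normal ?h_trace ?G_normal.
all: by field.
Qed.

Lemma contracted_T_inequality :
  let P i j k := \sum_a \sum_b h a b i * T a b j k in
  let W i j := \sum_a \sum_b w i a b * P a b j in
  9 / 40 * (\sum_l (2 * \sum_i \sum_j \sum_k h i j k * d l i j k) ^+ 2)
    - 1 / 3 * (\sum_i \sum_j (2^-1 * (W i j + W j i)) ^+ 2) <=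
  \sum_i \sum_j \sum_k P i j k ^+ 2 + 3 * (\sum_i \sum_j \sum_k P i j k * P j i k) :> R.
Proof.
cbv zeta; set P := fun i j k => \sum_a \sum_b h a b i * T a b j k.
have Psym i j k : P i k j = P i j k.
  by apply: eq_bigr => a _; apply: eq_bigr => b _; rewrite T_sym34.
have Ptr i : \sum_j P i j j = 0.
  rewrite /P exchange_big big1// => a _; rewrite exchange_big big1// => b _ /=.
  by rewrite -mulr_sumr T_trace mulr0.
have Pt l : \sum_i P i i l = \sum_i \sum_j \sum_k h i j k * d l i j k.
  rewrite -contract_T exchange_big; apply: eq_bigr => a _ /=.
  rewrite exchange_big; apply: eq_bigr => b _ /=; apply: eq_bigr => i _.
  by rewrite -T_sym34 -T_sym23 -T_sym12.
apply: le_trans (sum_sq_decomposition wE Psym Ptr); rewrite lerD2r.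
under eq_bigr do rewrite -Pt exprMn.
by rewrite -mulr_sumr mulrA le_eqVlt; apply/orP; left; apply/eqP; congr (_ * _); by field.
Qed.

End CubicForms.
End Tensors.

(** * Calculus *)

Section Calculus.
Variables (R : realType) (m : nat).
Local Notation V := 'rV[R]_m.+1.
Implicit Types (x v : V).

Lemma deriveDr (W : normedModType R) (g : V -> W) x v w :
  differentiable g x -> 'D_(v + w) g x = 'D_v g x + 'D_w g x.
Proof. by move=> dg; rewrite !deriveE// linearD. Qed.

Lemma deriveBr (W : normedModType R) (g : V -> W) x v w :
  differentiable g x -> 'D_(v - w) g x = 'D_v g x - 'D_w g x.
Proof. by move=> dg; rewrite !deriveE// linearB. Qed.

Lemma deriveZr (W : normedModType R) (g : V -> W) x k v :
  differentiable g x -> 'D_(k *: v) g x = k *: 'D_v g x.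
Proof. by move=> dg; rewrite !deriveE// linearZ. Qed.

Lemma derive_sumr (W : normedModType R) (g : V -> W) x (I : finType) (v : I -> V) :
  differentiable g x -> 'D_(\sum_i v i) g x = \sum_i 'D_(v i) g x.
Proof.
by move=> dg; rewrite deriveE// linear_sum; apply: eq_bigr => i _; rewrite deriveE.
Qed.

Lemma derive_basis (W : normedModType R) (g : V -> W) x v :
  differentiable g x -> 'D_v g x = \sum_i v 0 i *: 'D_(evec R i) g x.
Proof.
move=> dg; rewrite [in LHS](row_sum_delta v) derive_sumr//.
by apply: eq_bigr => i _; rewrite deriveZr.
Qed.

Lemma near_eq_differentiable (W : normedModType R) (g1 g2 : V -> W) x :
  (\near x, g1 x = g2 x) -> differentiable g1 x -> differentiable g2 x.
Proof.
move=> g12 /diff_locallyP[dc dg]; have g12x := nbhs_singleton g12.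
have dg2 : forall e : R, 0 < e ->
    \forall w \near nbhs (0 : V),
      `|g2 ((w : V) + x) - (g2 x + 'd g1 x (w : V))| <= e * `|w : V|.
  move=> e e0; move: dg => /eqaddoP /(_ e e0) dg.
  have g12' : \forall w \near nbhs (0 : V), g1 ((w : V) + x) = g2 ((w : V) + x).
    by move: g12; rewrite (near_shift 0 x) /= subr0.
  near=> w; rewrite -[in leLHS]g12x; have <- : g1 (w + x) = g2 (w + x) by near: w.
  by near: w.
have dE : 'd g2 x = 'd g1 x :> (_ -> _).
  by apply: diff_unique dc _; apply/eqaddoP.
by apply/diff_locallyP; rewrite dE; split=> //; apply/eqaddoP.
Unshelve. all: by end_near. Qed.

Lemma differentiable_coordP n (g : V -> 'rV[R]_n) x :
  differentiable g x <-> forall i, differentiable (fun u => g u 0 i) x.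
Proof.
split=> [dg i|dg].
  exact: (differentiable_comp dg (differentiable_coord _ _ _)).
rewrite (_ : g = \sum_(i < n) (fun u => g u 0 i *: delta_mx 0 i)).
  by apply: differentiable_sum => i; apply: differentiableZl.
by apply/funext => u; rewrite fct_sumE -row_sum_delta.
Qed.

Lemma derive_coord n (g : V -> 'rV[R]_n) x v i :
  differentiable g x -> 'D_v (fun u => g u 0 i) x = 'D_v g x 0 i.
Proof.
by move=> dg; rewrite derive_mx ?mxE//; exact: diff_derivable.
Qed.

Lemma scale_leibniz n (k : V -> R) (g : V -> 'rV[R]_n) x v :
  differentiable k x -> differentiable g x ->
  differentiable (fun u => k u *: g u) x /\
  'D_v (fun u => k u *: g u) x = 'D_v k x *: g x + k x *: 'D_v g x.
Proof.
move=> dk dg; have dgi i : differentiable (fun u => g u 0 i) x.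
  by move: i; apply/differentiable_coordP.
have d : differentiable (fun u => k u *: g u) x.
  apply/differentiable_coordP => i.
  rewrite (_ : (fun u => _) = (fun u => k u * g u 0 i)); last first.
    by apply/funext => u; rewrite mxE.
  exact: (differentiableM dk (dgi i)).
split=> //; apply/rowP => i; rewrite -derive_coord// !mxE.
rewrite (_ : (fun u => _) = (fun u => k u * g u 0 i)); last first.
  by apply/funext => u; rewrite mxE.
rewrite (@deriveM _ _ k (fun u => g u 0 i)); [|exact: diff_derivable..].
by rewrite derive_coord// addrC; congr (_ + _); rewrite mulrC.
Qed.

Lemma derive_sum_fun n (g : 'I_n -> V -> R) x v :
  (forall i, differentiable (g i) x) ->
  differentiable (fun u => \sum_i g i u) x /\
  'D_v (fun u => \sum_i g i u) x = \sum_i 'D_v (g i) x.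
Proof.
move=> dg; rewrite (_ : (fun u => _) = \sum_i g i); last first.
  by apply/funext => u; rewrite fct_sumE.
split; first exact: differentiable_sum.
by apply: derive_sum => i; exact: diff_derivable.
Qed.

Lemma derive_sqr (g : V -> R) x v : differentiable g x ->
  differentiable (fun u => g u ^+ 2) x /\
  'D_v (fun u => g u ^+ 2) x = 2 * (g x * 'D_v g x).
Proof.
move=> dg; rewrite (_ : (fun u => _) = g * g); last first.
  by apply/funext => u; rewrite expr2.
split; first exact: differentiableM.
apply: etrans (deriveM (diff_derivable dg) (diff_derivable dg)) _.
by rewrite mulr_natl mulr2n.
Qed.

Section Bilinear.
Variables (p q : nat) (W : normedModType R) (B : 'rV[R]_p -> 'rV[R]_q -> W).
Hypotheses (Bl : forall b, linear (B ^~ b)) (Br : forall a, linear (B a)).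

Lemma bilinear_coordE a b : B a b =
  \sum_i \sum_j (a 0 i * b 0 j) *: B (delta_mx 0 i) (delta_mx 0 j).
Proof.
pose Lr c : {linear 'rV[R]_q -> W} := HB.pack (B c) (GRing.isLinear.Build _ _ _ _ _ (Br c)).
pose Ll c : {linear 'rV[R]_p -> W} := HB.pack (B ^~ c) (GRing.isLinear.Build _ _ _ _ _ (Bl c)).
rewrite [in LHS](row_sum_delta a) -[LHS]/(Ll b _) linear_sum; apply: eq_bigr => i _.
rewrite linearZ /= [in LHS](row_sum_delta b) -[B _ _]/(Lr (delta_mx 0 i) _) linear_sum.
by rewrite scaler_sumr; apply: eq_bigr => j _; rewrite linearZ scalerA.
Qed.

Variables (g1 : V -> 'rV[R]_p) (g2 : V -> 'rV[R]_q) (x : V).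
Hypotheses (dg1 : differentiable g1 x) (dg2 : differentiable g2 x).

Lemma bilinear_leibniz v : differentiable (fun u => B (g1 u) (g2 u)) x /\
  'D_v (fun u => B (g1 u) (g2 u)) x = B ('D_v g1 x) (g2 x) + B (g1 x) ('D_v g2 x).
Proof.
have e : (fun u => B (g1 u) (g2 u)) = \sum_i \sum_j
    (fun u => (g1 u 0 i * g2 u 0 j) *: B (delta_mx 0 i) (delta_mx 0 j)).
  apply/funext => u; rewrite bilinear_coordE fct_sumE; apply: eq_bigr => i _.
  by rewrite fct_sumE.
have d1 i : differentiable (fun u => g1 u 0 i) x by move: i; apply/differentiable_coordP.
have d2 i : differentiable (fun u => g2 u 0 i) x by move: i; apply/differentiable_coordP.
have d12 i j : differentiable (fun u => g1 u 0 i * g2 u 0 j) x.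
  exact: (differentiableM (d1 i) (d2 j)).
split; rewrite e.
  by apply: differentiable_sum => i; apply: differentiable_sum => j;
    apply: differentiableZl.
rewrite derive_sum; last first.
  by move=> i; apply: diff_derivable; apply: differentiable_sum => j;
    apply: differentiableZl.
rewrite ![B _ _]bilinear_coordE -big_split; apply: eq_bigr => i _ /=.
rewrite derive_sum; last first.
  by move=> j; apply: diff_derivable; apply: differentiableZl.
rewrite -big_split; apply: eq_bigr => j _ /=.
rewrite deriveE; last exact: differentiableZl.
rewrite diffZl// -deriveE// (@deriveM _ _ (fun u => g1 u 0 i) (fun u => g2 u 0 j)).
- by rewrite !derive_coord// -scalerDl /=; congr (_ *: _); rewrite /GRing.scale /=; ring.
- exact: diff_derivable.
- exact: diff_derivable.
Qed.

End Bilinear.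

Lemma is_derive_line (g : V -> R) y a (s : R) : differentiable g (y + s *: a) ->
  is_derive s 1 (fun s => g (y + s *: a)) ('D_a g (y + s *: a)).
Proof.
move=> dg; pose l : R -> V := cst y + ( *:%R ^~ a : R -> V).
have sl : is_diff s ( *:%R ^~ a : R -> V) ( *:%R ^~ a) by exact: is_diff_scalel.
have ds : differentiable ( *:%R ^~ a : R -> V) s by case: sl.
have dc : differentiable (cst y : R -> V) s by exact: differentiable_cst.
have dl : differentiable l s by exact: differentiableD.
have dgl : differentiable (g \o l) s by exact: differentiable_comp.
have dlE : 'd l s 1 = a.
  have [_ E] := is_diffD (is_diff_cst y s) sl.
  have := congr1 (fun h : R -> V => h 1) E => ->.
  by rewrite -[LHS]/(0 + 1 *: a) add0r scale1r.
have -> : (fun s => g (y + s *: a)) = g \o l by [].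
apply: DeriveDef; first exact: diff_derivable.
have dgE := diff_comp dl dg.
have E1 : 'D_1 (g \o l) s = 'd (g \o l) s 1 by exact: deriveE.
have E2 : 'D_a g (y + s *: a) = 'd g (y + s *: a) a by exact: deriveE.
rewrite E1 E2.
have E3 : 'd (g \o l) s 1 = ('d g (l s) \o 'd l s) 1 by rewrite dgE.
rewrite E3.
by rewrite -[LHS]/('d g (l s) ('d l s 1)) dlE.
Qed.

(* The mean value theorem in the direction a reduces the second difference to
   the increment of 'D_a g between two points close to x. *)
Lemma second_difference (g : V -> R) x a b :
  (\near x, differentiable g x) -> differentiable ('D_a g) x ->
  forall e : R, 0 < e -> exists2 d : R, 0 < d & forall t, 0 < t -> t < d ->
  `|g (x + t *: a + t *: b) - g (x + t *: a) - g (x + t *: b) + g x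
    - t ^+ 2 * 'D_b ('D_a g) x| <= e * t ^+ 2.
Proof.
move=> dg dG e e0; set C := `|a| + `|b| + 1.
have C0 : 0 < C by rewrite ltr_wpDl// addr_ge0.
have e'0 : 0 < e / (2 * C) by rewrite divr_gt0// mulr_gt0.
have : \forall w \near nbhs (0 : V), differentiable g ((w : V) + x) /\
    `|'D_a g ((w : V) + x) - ('D_a g x + 'd ('D_a g) x (w : V))|
      <= e / (2 * C) * `|w : V|.
  near=> w; split; near: w.
    by move: dg; rewrite (near_shift 0 x) /= subr0.
  by move: dG => /diff_locallyP[_ /eqaddoP /(_ _ e'0)].
move=> /nbhs_norm0P[d /= d0 dP]; exists (d / C); first by rewrite divr_gt0.
move=> t t0; rewrite ltr_pdivlMr// => td.
have small s u : 0 <= s -> s <= t -> 0 <= u -> u <= t ->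
    `|s *: a + u *: b| <= t * (C - 1).
  move=> s0 st u0 ut; rewrite /C addrK mulrDr (le_trans (ler_normD _ _))//.
  by rewrite !normrZ !ger0_norm// lerD// ler_wpM2r.
have tC : t * (C - 1) < d by rewrite (le_lt_trans _ td)// ler_wpM2l ?ltW// gtrBl.
pose phi (s : R) := g (x + t *: b + s *: a) - g (x + s *: a).
pose dphi (s : R) := 'D_a g (x + t *: b + s *: a) - 'D_a g (x + s *: a).
have E1 s : x + t *: b + s *: a = s *: a + t *: b + x.
  by rewrite addrC (addrC x) addrA.
have E2 s : x + s *: a = s *: a + 0 *: b + x by rewrite scale0r addr0 addrC.
have P1 s : 0 <= s -> s <= t -> `|s *: a + t *: b| < d.
  by move=> s0 st; rewrite (le_lt_trans (small _ _ _ _ _ _))// ltW.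
have P2 s : 0 <= s -> s <= t -> `|s *: a + 0 *: b| < d.
  by move=> s0 st; rewrite (le_lt_trans (small _ _ _ _ _ _))// ltW.
have dphiE s : 0 <= s -> s <= t -> is_derive s 1 phi (dphi s).
  move=> s0 st; apply: is_deriveB; apply: is_derive_line.
    by rewrite E1; have [] := dP _ (P1 _ s0 st).
  by rewrite E2; have [] := dP _ (P2 _ s0 st).
have phiD s : s \in `]0, t[%R -> is_derive s 1 phi (dphi s).
  by rewrite in_itv /= => /andP[/ltW s0 /ltW st]; exact: dphiE.
have phiC : {within `[0, t], continuous phi}.
  apply: derivable_within_continuous => s; rewrite in_itv /= => /andP[s0 st].
  by have [] := dphiE _ s0 st.
have [c] := MVT t0 phiD phiC.
rewrite in_itv /= => /andP[/ltW c0 /ltW ct]; rewrite subr0 => phiE.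
have -> : g (x + t *: a + t *: b) - g (x + t *: a) - g (x + t *: b) + g x
    = phi t - phi 0.
  by rewrite /phi !scale0r !addr0 [x + t *: b + _]addrAC; ring.
rewrite phiE deriveE//.
have [_ G1] := dP _ (P1 _ c0 ct); have [_ G2] := dP _ (P2 _ c0 ct).
rewrite -E1 in G1; rewrite -E2 in G2.
have K u : u <= t * (C - 1) -> e / (2 * C) * u <= e / 2 * t.
  move=> ut; rewrite invfM mulrA -mulrA ler_wpM2l//; first by rewrite divr_ge0// ltW.
  rewrite mulrC ler_pdivrMr// (le_trans ut)// ler_wpM2l ?ltW// gtrBl//.
have {}G1 := le_trans G1 (K _ (small _ _ c0 ct (ltW t0) (lexx t))).
have {}G2 := le_trans G2 (K _ (small _ _ c0 ct (lexx 0) (ltW t0))).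
have lin p q : 'd ('D_a g) x (p *: a + q *: b) = p * 'd ('D_a g) x a + q * 'd ('D_a g) x b.
  by rewrite linearD !linearZ.
rewrite !{}lin in G1 G2.
have -> : dphi c * t - t ^+ 2 * 'd ('D_a g) x b =
    t * (dphi c - t * 'd ('D_a g) x b) by ring.
have -> : e * t ^+ 2 = t * (t * e) by ring.
rewrite normrM gtr0_norm//; apply: ler_wpM2l; first exact: ltW.
move: G1 G2; rewrite /dphi.
move: ('d _ _ _) ('d _ _ _) ('D_a g _) ('D_a g _) ('D_a g _) => A B D1 D2 D3.
by rewrite !ler_norml => /andP[G1 G1'] /andP[G2 G2']; apply/andP; split; lra.
Unshelve. all: by end_near. Qed.

Lemma derive_comm_scalar (g : V -> R) x a b :
  (\near x, differentiable g x) ->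
  differentiable ('D_a g) x -> differentiable ('D_b g) x ->
  'D_b ('D_a g) x = 'D_a ('D_b g) x.
Proof.
move=> dg da db; apply/subr0_eq/normr0_eq0/eqP; rewrite eq_le normr_ge0 andbT.
apply/ler_addgt0Pr => e e0; rewrite add0r.
have e2 : 0 < e / 2 by rewrite divr_gt0.
have [d1 d10 H1] := @second_difference g x a b dg da _ e2.
have [d2 d20 H2] := @second_difference g x b a dg db _ e2.
pose t := Num.min d1 d2 / 2.
have t0 : 0 < t by rewrite divr_gt0// lt_min d10.
have [td1 td2] : t < d1 /\ t < d2.
  have m0 : 0 < Num.min d1 d2 by rewrite lt_min d10.
  have m1 : Num.min d1 d2 <= d1 by rewrite ge_min lexx.
  have m2 : Num.min d1 d2 <= d2 by rewrite ge_min lexx orbT.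
  by rewrite /t; split; lra.
have {}H1 := H1 _ t0 td1; have {}H2 := H2 _ t0 td2.
rewrite [x + t *: b + _]addrAC in H2.
have t20 : 0 < t ^+ 2 by rewrite exprn_gt0.
rewrite -(ler_pM2l t20) -[X in X * `|_|](gtr0_norm t20) -normrM.
move: ('D_b _ _) ('D_a _ _) H1 H2 => A B.
by rewrite !ler_norml => /andP[G1 G1'] /andP[G2 G2']; apply/andP; split; lra.
Qed.

Lemma derive_comm n (g : V -> 'rV[R]_n) x a b :
  (\near x, differentiable g x) ->
  differentiable ('D_a g) x -> differentiable ('D_b g) x ->
  'D_b ('D_a g) x = 'D_a ('D_b g) x.
Proof.
move=> dg da db; apply/rowP => i.
have E c : \near x, 'D_c g x 0 i = 'D_c (fun u => g u 0 i) x.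
  by apply: filterS dg => u dgu; rewrite derive_coord.
have dgi : \near x, differentiable (fun u => g u 0 i) x.
  by apply: filterS dg => u; move/differentiable_coordP.
have D c : differentiable ('D_c g) x -> differentiable ('D_c (fun u => g u 0 i)) x.
  move=> dc; apply: (@near_eq_differentiable _ (fun u => 'D_c g u 0 i)); first exact: E.
  by move: i {E dgi}; apply/differentiable_coordP.
have C := derive_comm_scalar dgi (D a da) (D b db).
apply: etrans (esym (derive_coord b i da)) _.
apply: etrans (near_eq_derive _ (E a)) _; apply: etrans C _.
by apply: etrans (esym (near_eq_derive _ (E b))) _; exact: derive_coord.
Qed.

Lemma derive_field n (g : V -> 'rV[R]_n) (Y : V -> V) x v :
  (\near x, differentiable g x) ->
  (forall k, differentiable ('D_(evec R k) g) x) -> differentiable Y x ->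
  differentiable (fun u => 'D_(Y u) g u) x /\
  'D_v (fun u => 'D_(Y u) g u) x =
    'D_('D_v Y x) g x + \sum_k Y x 0 k *: 'D_v ('D_(evec R k) g) x.
Proof.
move=> dg dkg dY.
have dYk k : differentiable (fun u => Y u 0 k) x by move: k; apply/differentiable_coordP.
have L k := scale_leibniz v (dYk k) (dkg k).
pose S := \sum_k (fun u => Y u 0 k *: 'D_(evec R k) g u).
have E : \near x, S x = 'D_(Y x) g x.
  by near=> u; rewrite /S fct_sumE derive_basis//; near: u.
split.
  by apply: near_eq_differentiable E _; rewrite /S; apply: differentiable_sum => k; case: (L k).
rewrite -(near_eq_derive _ E) /S derive_sum; last first.
  by move=> k; apply: diff_derivable; case: (L k).
rewrite derive_basis ?(nbhs_singleton dg)//; last exact: nbhs_singleton dg.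
rewrite -big_split; apply: eq_bigr => k _ /=.
by rewrite (L k).2 derive_coord.
Unshelve. all: by end_near. Qed.

Lemma derive_bracket n (g : V -> 'rV[R]_n) (X Y : V -> V) x :
  (\near x, differentiable g x) ->
  (forall k, differentiable ('D_(evec R k) g) x) ->
  differentiable X x -> differentiable Y x ->
  'D_(X x) (fun u => 'D_(Y u) g u) x - 'D_(Y x) (fun u => 'D_(X u) g u) x =
  'D_('D_(X x) Y x - 'D_(Y x) X x) g x.
Proof.
move=> dg dkg dX dY; have dgx := nbhs_singleton dg.
have [_ ->] := derive_field (X x) dg dkg dY.
have [_ ->] := derive_field (Y x) dg dkg dX.
rewrite deriveBr// opprD addrACA.
rewrite [X in _ + X](_ : _ = 0) ?addr0//; apply/eqP; rewrite subr_eq0; apply/eqP.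
have H (Z W : V) : \sum_k Z 0 k *: 'D_W ('D_(evec R k) g) x =
    \sum_k \sum_j (Z 0 k * W 0 j) *: 'D_(evec R j) ('D_(evec R k) g) x.
  apply: eq_bigr => k _; rewrite (derive_basis W (dkg k)) scaler_sumr.
  by apply: eq_bigr => j _; rewrite scalerA.
apply: etrans (H (Y x) (X x)) _; apply: etrans _ (esym (H (X x) (Y x))).
apply: etrans (exchange_big _ _ _ _ _ _) _.
apply: eq_bigr => j _; apply: eq_bigr => k _.
have C := derive_comm dg (dkg k) (dkg j).
apply: etrans (congr1 (fun z => z *: _) (mulrC _ _)) _.
exact: (congr1 (fun z => _ *: z) C).
Qed.

End Calculus.

(** * The cross product of R^7 *)

Section Dot.
Variables (R : realType) (n : nat).
Implicit Types u v w : 'rV[R]_n.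

Lemma dotC u v : dot u v = dot v u.
Proof. by apply: eq_bigr => i _; rewrite mulrC. Qed.

Lemma dot_linearl v : linear (fun u => dot u v : R^o).
Proof.
move=> k u u'; rewrite /dot scaler_sumr -big_split; apply: eq_bigr => i _ /=.
by rewrite !mxE mulrDl -mulrA.
Qed.

Lemma dot_linearr u : linear (fun v => dot u v : R^o).
Proof. by move=> k v v'; rewrite dotC dot_linearl !(dotC u). Qed.

Lemma dotDl u v w : dot (u + v) w = dot u w + dot v w.
Proof. by have := dot_linearl w 1 u v; rewrite !scale1r. Qed.

Lemma dotZl k u w : dot (k *: u) w = k * dot u w.
Proof.
by rewrite /dot mulr_sumr; apply: eq_bigr => i _; rewrite mxE mulrA.
Qed.

Lemma dotNl u w : dot (- u) w = - dot u w.
Proof. by rewrite -scaleN1r dotZl mulN1r. Qed.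

Lemma dotBl u v w : dot (u - v) w = dot u w - dot v w.
Proof. by rewrite dotDl dotNl. Qed.

Lemma dot_suml (I : finType) (F : I -> 'rV[R]_n) w :
  dot (\sum_i F i) w = \sum_i dot (F i) w.
Proof.
rewrite /dot exchange_big; apply: eq_bigr => j _ /=.
by rewrite summxE mulr_suml.
Qed.

Lemma dotDr u v w : dot u (v + w) = dot u v + dot u w.
Proof. by rewrite dotC dotDl !(dotC u). Qed.

Lemma dotZr k u w : dot u (k *: w) = k * dot u w.
Proof. by rewrite dotC dotZl dotC. Qed.

Lemma dot_sumr (I : finType) u (F : I -> 'rV[R]_n) :
  dot u (\sum_i F i) = \sum_i dot u (F i).
Proof. by rewrite dotC dot_suml; apply: eq_bigr => i _; rewrite dotC. Qed.

Lemma dot_mulmx u v : u *m v^T = (dot u v)%:M.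
Proof.
apply/rowP => i; rewrite !mxE ord1 eqxx.
by apply: eq_bigr => j _; rewrite mxE.
Qed.

End Dot.

Section Cross.
Variable R : realType.
Implicit Types a b c d : 'rV[R]_7.

Local Notation x_ a k := (a 0 (inord k)).

Lemma sum7 (A : nmodType) (F : 'I_7 -> A) :
  \sum_i F i = F (inord 0) + F (inord 1) + F (inord 2) + F (inord 3)
             + F (inord 4) + F (inord 5) + F (inord 6).
Proof.
rewrite !big_ord_recl big_ord0 addr0 !addrA.
by congr (F _ + F _ + F _ + F _ + F _ + F _ + F _); apply/val_inj; rewrite /= inordK.
Qed.

Lemma cross_coord a b : cross a b = \row_i nth 0
  [:: x_ a 1 * x_ b 2 + x_ a 3 * x_ b 4 + x_ a 6 * x_ b 5
        - x_ a 2 * x_ b 1 - x_ a 4 * x_ b 3 - x_ a 5 * x_ b 6;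
      x_ a 2 * x_ b 0 + x_ a 3 * x_ b 5 + x_ a 4 * x_ b 6
        - x_ a 0 * x_ b 2 - x_ a 5 * x_ b 3 - x_ a 6 * x_ b 4;
      x_ a 0 * x_ b 1 + x_ a 3 * x_ b 6 + x_ a 5 * x_ b 4
        - x_ a 1 * x_ b 0 - x_ a 4 * x_ b 5 - x_ a 6 * x_ b 3;
      x_ a 4 * x_ b 0 + x_ a 5 * x_ b 1 + x_ a 6 * x_ b 2
        - x_ a 0 * x_ b 4 - x_ a 1 * x_ b 5 - x_ a 2 * x_ b 6;
      x_ a 0 * x_ b 3 + x_ a 2 * x_ b 5 + x_ a 6 * x_ b 1
        - x_ a 1 * x_ b 6 - x_ a 3 * x_ b 0 - x_ a 5 * x_ b 2;
      x_ a 0 * x_ b 6 + x_ a 1 * x_ b 3 + x_ a 4 * x_ b 2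
        - x_ a 2 * x_ b 4 - x_ a 3 * x_ b 1 - x_ a 6 * x_ b 0;
      x_ a 1 * x_ b 4 + x_ a 2 * x_ b 3 + x_ a 5 * x_ b 0
        - x_ a 0 * x_ b 5 - x_ a 3 * x_ b 2 - x_ a 4 * x_ b 1] i.
Proof.
rewrite /cross /im_of_cayley; apply/rowP => i; rewrite [RHS]mxE [LHS]mxE.
case: i => -[|[|[|[|[|[|[|i]]]]]]] //= _; rewrite /GRing.scale /=; by field.
Qed.

Lemma cross_linearl b : linear (fun a => cross a b).
Proof.
move=> k a a'; rewrite !cross_coord; apply/rowP => i; rewrite !mxE.
case: i => -[|[|[|[|[|[|[|i]]]]]]] //= _; ring.
Qed.

Lemma cross_linearr a : linear (cross a).
Proof.
move=> k b b'; rewrite !cross_coord; apply/rowP => i; rewrite !mxE.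
case: i => -[|[|[|[|[|[|[|i]]]]]]] //= _; ring.
Qed.

Lemma cross_sumZr a (k : 'I_3 -> R) (b : 'I_3 -> 'rV[R]_7) :
  cross a (\sum_i k i *: b i) = \sum_i k i *: cross a (b i).
Proof.
pose L : {linear 'rV[R]_7 -> 'rV[R]_7} :=
  HB.pack (cross a) (GRing.isLinear.Build _ _ _ _ _ (cross_linearr a)).
rewrite -[LHS]/(L _) linear_sum; apply: eq_bigr => i _.
by rewrite linearZ.
Qed.

Lemma crossC a b : cross a b = - cross b a.
Proof.
rewrite !cross_coord; apply/rowP => i; rewrite !mxE.
case: i => -[|[|[|[|[|[|[|i]]]]]]] //= _; ring.
Qed.

Lemma crossvv a : cross a a = 0.
Proof.
rewrite !cross_coord; apply/rowP => i; rewrite !mxE.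
case: i => -[|[|[|[|[|[|[|i]]]]]]] //= _; ring.
Qed.

Lemma dot_cross_cycle a b c : dot (cross a b) c = dot a (cross b c).
Proof.
rewrite !cross_coord /dot !sum7 !mxE !inordK//=; ring.
Qed.

Lemma dot_cross_cross a b c d :
  dot (cross a b) (cross d c) + dot (cross d b) (cross a c) =
  2 * dot a d * dot b c - dot a b * dot d c - dot d b * dot a c.
Proof.
rewrite !cross_coord /dot !sum7 !mxE !inordK//=.
move: (a 0 (inord 0)) (a 0 (inord 1)) (a 0 (inord 2)) (a 0 (inord 3))
  (a 0 (inord 4)) (a 0 (inord 5)) (a 0 (inord 6)) => a0 a1 a2 a3 a4 a5 a6.
move: (b 0 (inord 0)) (b 0 (inord 1)) (b 0 (inord 2)) (b 0 (inord 3))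
  (b 0 (inord 4)) (b 0 (inord 5)) (b 0 (inord 6)) => b0 b1 b2 b3 b4 b5 b6.
move: (c 0 (inord 0)) (c 0 (inord 1)) (c 0 (inord 2)) (c 0 (inord 3))
  (c 0 (inord 4)) (c 0 (inord 5)) (c 0 (inord 6)) => c0 c1 c2 c3 c4 c5 c6.
move: (d 0 (inord 0)) (d 0 (inord 1)) (d 0 (inord 2)) (d 0 (inord 3))
  (d 0 (inord 4)) (d 0 (inord 5)) (d 0 (inord 6)) => d0 d1 d2 d3 d4 d5 d6.
ring.
Qed.

Lemma dot_cross_unit x a b : dot x x = 1 -> dot x a = 0 ->
  dot (cross x a) (cross x b) = dot a b.
Proof.
have alg (p c xx xa xb : R) : p + p = 2 * xx * c - xa * xb - xa * xb ->
    xx = 1 -> xa = 0 -> p = c.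
  by move=> H xx1 xa0; rewrite xx1 xa0 in H; lra.
by move=> xx xa; apply: alg (dot_cross_cross x a b x) xx xa.
Qed.

Lemma dot_crossD_cycle a a' b b' c : dot (cross a' b + cross a b') c =
  dot (cross b c) a' + dot (cross c a) b'.
Proof.
apply: etrans (dotDl _ _ _) _; apply: f_equal2.
  by apply: etrans (dot_cross_cycle a' b c) _; exact: dotC.
by apply: etrans (dotC _ c) _; exact: esym (dot_cross_cycle c a b').
Qed.

Lemma dot_cross_skew a b c d : dot a d = 0 -> dot d b = 0 -> dot d c = 0 ->
  dot (cross a c) (cross d b) = - dot (cross a b) (cross d c).
Proof.
have alg (x y t ab ac ad bc db dc : R) : x + y = 2 * ad * bc - ab * dc - db * ac ->
    ad = 0 -> db = 0 -> dc = 0 -> y = t -> t = - x.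
  by move=> H ad0 db0 dc0 <-; rewrite ad0 db0 dc0 in H; lra.
by move=> ad db dc; apply: (alg _ _ _ _ _ _ _ _ _ (dot_cross_cross a b c d) ad db dc); exact: dotC.
Qed.

End Cross.

Lemma parseval (R : realType) (f : 'rV[R]_7) (E N : 'I_3 -> 'rV[R]_7) :
  dot f f = 1 -> (forall i, dot f (E i) = 0) -> (forall i, dot f (N i) = 0) ->
  (forall i j, dot (E i) (E j) = (i == j)%:R) ->
  (forall i j, dot (N i) (N j) = (i == j)%:R) ->
  (forall i j, dot (E i) (N j) = 0) ->
  forall u v, dot u v = dot u f * dot v f + \sum_i dot u (E i) * dot v (E i)
    + \sum_i dot u (N i) * dot v (N i).
Proof.
move=> ff fE fN EE NN EN u v.
pose ME := \matrix_i E i; pose MN := \matrix_i N i.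
have MM (A B : 'I_3 -> 'rV[R]_7) i j :
    ((\matrix_i A i) *m (\matrix_i B i)^T) i j = dot (A i) (B j).
  by rewrite !mxE; apply: eq_bigr => k _; rewrite !mxE.
have fM (A : 'I_3 -> 'rV[R]_7) : (forall i, dot f (A i) = 0) -> f *m (\matrix_i A i)^T = 0.
  move=> fA; apply/rowP => j; rewrite !mxE -[RHS](fA j).
  by apply: eq_bigr => k _; rewrite !mxE.
pose Q : 'M[R]_(1 + (3 + 3)) := col_mx f (col_mx ME MN).
have QQ : Q *m Q^T = 1%:M.
  rewrite /Q !tr_col_mx mul_col_row !mul_mx_row !mul_col_mx.
  have E1 : f *m f^T = 1%:M by rewrite dot_mulmx ff.
  have E2 : f *m ME^T = 0 by exact: fM.
  have E3 : f *m MN^T = 0 by exact: fM.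
  have E4 : ME *m f^T = 0 by rewrite -[LHS]trmxK trmx_mul trmxK E2 trmx0.
  have E5 : MN *m f^T = 0 by rewrite -[LHS]trmxK trmx_mul trmxK E3 trmx0.
  have E6 : ME *m ME^T = 1%:M by apply/matrixP => i j; rewrite MM mxE EE.
  have E7 : MN *m MN^T = 1%:M by apply/matrixP => i j; rewrite MM mxE NN.
  have E8 : ME *m MN^T = 0 by apply/matrixP => i j; rewrite MM mxE EN.
  have E9 : MN *m ME^T = 0 by rewrite -[LHS]trmxK trmx_mul trmxK E8 trmx0.
  rewrite E1 E2 E3 E4 E5 E6 E7 E8 E9 row_mx0 col_mx0.
  by rewrite -block_mxEh -!scalar_mx_block.
have {}QQ : Q^T *m Q = 1%:M by exact: mulmx1C QQ.
have D (A : 'I_3 -> 'rV[R]_7) : u *m (\matrix_i A i)^T *m (\matrix_i A i *m v^T)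
    = (\sum_i dot u (A i) * dot v (A i))%:M.
  apply/rowP => i; rewrite !mxE ord1 eqxx; apply: eq_bigr => j _.
  rewrite !mxE [dot v _]dotC; congr (_ * _); apply: eq_bigr => k _; by rewrite !mxE.
have : u *m (Q^T *m Q) *m v^T = (dot u v)%:M by rewrite QQ mulmx1 dot_mulmx.
rewrite /Q !tr_col_mx !mul_row_col !mulmxDr !mulmxDl !mulmxA -!(mulmxA _ _ v^T).
rewrite !D !dot_mulmx -scalar_mxM -!raddfD /= [dot f v]dotC addrA.
by move/matrixP/(_ 0 0); rewrite !mxE eqxx.
Qed.

(** * Lagrangian immersions in an adapted frame *)

Section Leibniz.
Variables (R : realType) (m n : nat).

Lemma derive_dot (a b : 'rV[R]_m.+1 -> 'rV[R]_n) u v :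
  differentiable a u -> differentiable b u ->
  differentiable (fun u => dot (a u) (b u)) u /\
  'D_v (fun u => dot (a u) (b u)) u = dot ('D_v a u) (b u) + dot (a u) ('D_v b u).
Proof.
move=> da db.
exact: (@bilinear_leibniz R m n n R (fun a b => dot a b) (@dot_linearl R n)
  (@dot_linearr R n) a b u da db v).
Qed.

Lemma derive_cross (a b : 'rV[R]_m.+1 -> 'rV[R]_7) u v :
  differentiable a u -> differentiable b u ->
  differentiable (fun u => cross (a u) (b u)) u /\
  'D_v (fun u => cross (a u) (b u)) u = cross ('D_v a u) (b u) + cross (a u) ('D_v b u).
Proof.
move=> da db.
exact: (@bilinear_leibniz R m 7 7 _ (fun a b => cross a b) (@cross_linearl R)
  (@cross_linearr R) a b u da db v).
Qed.

End Leibniz.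

Section Geometry.
Variables (R : realType) (V : set 'rV[R]_3).
Variables (f : 'rV[R]_3 -> 'rV[R]_7) (e : 'I_3 -> 'rV[R]_3 -> 'rV[R]_3).
Hypotheses (oV : open V) (fS : smooth_on V f) (ff1 : forall u, V u -> dot (f u) (f u) = 1).
Hypothesis fL : forall u v w, V u -> dot (cross (f u) ('D_v f u)) ('D_w f u) = 0.
Hypothesis eS : forall i, smooth_on V (e i).
Hypothesis eO : forall u, V u -> forall i j,
  dot (push f (e i) u) (push f (e j) u) = (i == j)%:R.
Hypothesis eP : forall u, V u ->
  0 < omega f (e (inord 0)) (e (inord 1)) (e (inord 2)) u.

Local Notation E i := (push f (e i)).
Local Notation N i := (Jop f (push f (e i))).
Local Notation DE i j := (fun u => 'D_(e i u) (E j) u).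

Lemma nearV u : V u -> \forall v \near u, V v.
Proof. by move=> Vu; apply: open_nbhs_nbhs. Qed.

Lemma eqV_derive (W : normedModType R) (g1 g2 : 'rV[R]_3 -> W) u w :
  V u -> (forall v, V v -> g1 v = g2 v) -> 'D_w g1 u = 'D_w g2 u.
Proof. by move=> Vu g12; apply: near_eq_derive; apply: filterS (nearV Vu). Qed.

Lemma eqV_diff (W : normedModType R) (g1 g2 : 'rV[R]_3 -> W) u :
  V u -> (forall v, V v -> g1 v = g2 v) -> differentiable g1 u -> differentiable g2 u.
Proof. by move=> Vu g12; apply: near_eq_differentiable; apply: filterS (nearV Vu). Qed.

Lemma f_diff u : V u -> differentiable f u. Proof. exact: (fS [::]). Qed.

Lemma df_diff k u : V u -> differentiable ('D_(evec R k) f) u.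
Proof. exact: (fS [:: k]). Qed.

Lemma ddf_diff k l u : V u -> differentiable ('D_(evec R k) ('D_(evec R l) f)) u.
Proof. exact: (fS [:: k; l]). Qed.

Lemma e_diff i u : V u -> differentiable (e i) u. Proof. exact: (@eS i [::]). Qed.

Lemma de_diff i k u : V u -> differentiable ('D_(evec R k) (e i)) u.
Proof. exact: (@eS i [:: k]). Qed.

Lemma f_diff_near u : V u -> \forall v \near u, differentiable f v.
Proof. by move=> /nearV; apply: filterS => v; exact: f_diff. Qed.

Lemma derive_push X u v : V u -> differentiable X u ->
  differentiable (push f X) u /\ 'D_v (push f X) u =
    'D_('D_v X u) f u + \sum_k X u 0 k *: 'D_v ('D_(evec R k) f) u.
Proof.
move=> Vu dX; apply: derive_field => //; first exact: f_diff_near.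
by move=> k; exact: df_diff.
Qed.

Lemma E_diff i u : V u -> differentiable (E i) u.
Proof. by move=> Vu; have [] := derive_push 0 Vu (e_diff i Vu). Qed.

Lemma coord_diff n (g : 'rV[R]_3 -> 'rV[R]_n) u k :
  differentiable g u -> differentiable (fun v => g v 0 k) u.
Proof. by move=> dg; move: k; apply/differentiable_coordP. Qed.

Lemma dE_diff i k u : V u -> differentiable ('D_(evec R k) (E i)) u.
Proof.
move=> Vu; pose X := 'D_(evec R k) (e i).
pose S := \sum_l (fun v => e i v 0 l *: 'D_(evec R k) ('D_(evec R l) f) v).
have SE v : V v -> (push f X + S) v = 'D_(evec R k) (E i) v.
  move=> Vv; apply: etrans (esym (derive_push (evec R k) Vv (e_diff i Vv)).2).
  by apply: (congr1 (fun z => _ + z)); rewrite /S fct_sumE.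
apply: (eqV_diff Vu SE); apply: differentiableD.
  by have [] := derive_push 0 Vu (de_diff i k Vu).
apply: differentiable_sum => l.
by have [] := scale_leibniz 0 (coord_diff l (e_diff i Vu)) (ddf_diff k l Vu).
Qed.

Lemma DE_diff i j u : V u -> differentiable (DE i j) u.
Proof.
move=> Vu; have nE : \forall v \near u, differentiable (E j) v.
  by apply: filterS (nearV Vu) => v; exact: E_diff.
exact: (derive_field 0 nE (fun k => dE_diff j k Vu) (e_diff i Vu)).1.
Qed.

Lemma derive_N i u v : V u -> differentiable (N i) u /\
  'D_v (N i) u = cross ('D_v f u) (E i u) + cross (f u) ('D_v (E i) u).
Proof. by move=> Vu; apply: derive_cross; [exact: f_diff|exact: E_diff]. Qed.

Lemma N_diff i u : V u -> differentiable (N i) u.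
Proof. by move=> Vu; have [] := derive_N i 0 Vu. Qed.

Lemma derive_dot_const n (a b : 'rV[R]_3 -> 'rV[R]_n) c u v : V u ->
  differentiable a u -> differentiable b u ->
  (forall w, V w -> dot (a w) (b w) = c) ->
  dot ('D_v a u) (b u) = - dot (a u) ('D_v b u).
Proof.
move=> Vu da db abc; apply/eqP; rewrite -addr_eq0; apply/eqP.
apply: etrans (esym (derive_dot v da db).2) _.
apply: etrans (eqV_derive v Vu (_ : forall w, V w -> _ = cst c w)) _ => //.
exact: derive_cst.
Qed.

Lemma dot_f_df u v : V u -> dot (f u) ('D_v f u) = 0.
Proof.
move=> Vu; have := derive_dot_const v Vu (f_diff Vu) (f_diff Vu) ff1.
rewrite dotC; lra.
Qed.

Lemma dot_f_N i u : dot (f u) (N i u) = 0.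
Proof. by rewrite -dot_cross_cycle crossvv /dot big1// => j _; rewrite mxE mul0r. Qed.

Lemma dot_df_N v i u : V u -> dot ('D_v f u) (N i u) = 0.
Proof. by move=> Vu; rewrite dotC fL. Qed.

Lemma dot_N_N i j u : V u -> dot (N i u) (N j u) = (i == j)%:R.
Proof.
move=> Vu; rewrite -(eO Vu i j).
exact: (dot_cross_unit _ (ff1 Vu) (dot_f_df _ Vu)).
Qed.

Lemma parsevalV u a b : V u -> dot a b = dot a (f u) * dot b (f u)
  + \sum_i dot a (E i u) * dot b (E i u) + \sum_i dot a (N i u) * dot b (N i u).
Proof.
move=> Vu; apply: (parseval (ff1 Vu)).
- by move=> i; exact: dot_f_df.
- by move=> i; exact: dot_f_N.
- exact: eO.
- by move=> i j; exact: dot_N_N.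
- by move=> i j; exact: dot_df_N.
Qed.

Lemma dot_df v w u : V u -> dot ('D_v f u) ('D_w f u) =
  \sum_b (\sum_a v 0 a * metric f u a b) * w 0 b.
Proof.
move=> Vu; have df := f_diff Vu.
rewrite (derive_basis w df) dot_sumr; apply: eq_bigr => b _.
rewrite dotZr (derive_basis v df) dot_suml mulrC; congr (_ * _).
by apply: eq_bigr => a _; rewrite dotZl mxE.
Qed.

Local Notation B u := (\matrix_(a, k) e a u 0 k).

Lemma metric_frame u : V u -> metric f u *m (B u)^T *m B u = 1%:M.
Proof.
move=> Vu; apply: mulmx1C; rewrite mulmxA; apply/matrixP => i j.
rewrite [RHS]mxE -(eO Vu i j) (dot_df _ _ Vu) !mxE; apply: eq_bigr => b _.
by rewrite !mxE; congr (_ * _); apply: eq_bigr => a _; rewrite !mxE.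
Qed.

Lemma invmx_metric u : V u -> invmx (metric f u) = (B u)^T *m B u.
Proof.
move=> Vu; have := metric_frame Vu; rewrite -mulmxA => gC.
by have [gU _] := mulmx1_unit gC; rewrite -[RHS](mulKmx gU) gC mulmx1.
Qed.

Lemma frame_expand v u : V u -> v = \sum_a dot ('D_v f u) (E a u) *: e a u.
Proof.
move=> Vu; rewrite -[LHS]mulmx1 -(metric_frame Vu) !mulmxA.
apply/rowP => k; rewrite mxE summxE; apply: eq_bigr => a _.
rewrite [RHS]mxE [B u a k]mxE; congr (_ * _); rewrite (dot_df _ _ Vu) !mxE.
by apply: eq_bigr => b _; rewrite !mxE.
Qed.

Lemma raise_index (phi : 'I_3 -> R) u : V u ->
  \row_k \sum_l invmx (metric f u) k l * phi l =
  \sum_a (\sum_l e a u 0 l * phi l) *: e a u.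
Proof.
move=> Vu; apply/rowP => k; rewrite mxE summxE (invmx_metric Vu).
under eq_bigr do rewrite mxE mulr_suml.
rewrite exchange_big; apply: eq_bigr => a _ /=; rewrite [RHS]mxE mulr_suml.
by apply: eq_bigr => l _; rewrite !mxE; ring.
Qed.

Lemma df_expand v u : V u -> 'D_v f u = \sum_a dot ('D_v f u) (E a u) *: E a u.
Proof.
move=> Vu; rewrite [in LHS](frame_expand v Vu) (derive_sumr _ (f_diff Vu)).
by apply: eq_bigr => a _; exact: (deriveZr _ _ (f_diff Vu)).
Qed.

Lemma ddf_comm k l u : V u ->
  'D_(evec R k) ('D_(evec R l) f) u = 'D_(evec R l) ('D_(evec R k) f) u.
Proof.
by move=> Vu; apply: (derive_comm (f_diff_near Vu)); exact: df_diff.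
Qed.

Lemma metric_sym u i j : metric f u i j = metric f u j i.
Proof. by rewrite !mxE; exact: dotC. Qed.

Lemma derive_metric u m i j : V u -> 'D_(evec R m) (fun v => metric f v i j) u =
  dot ('D_(evec R m) ('D_(evec R i) f) u) ('D_(evec R j) f u)
  + dot ('D_(evec R i) f u) ('D_(evec R m) ('D_(evec R j) f) u).
Proof.
move=> Vu; apply: etrans (derive_dot _ (df_diff i Vu) (df_diff j Vu)).2.
by apply: (eqV_derive _ Vu) => v _; rewrite mxE.
Qed.

Lemma metric_christoffel u i j l : V u ->
  \sum_k christoffel f u k i j * metric f u k l =
  dot ('D_(evec R i) ('D_(evec R j) f) u) ('D_(evec R l) f u).
Proof.
move=> Vu.
have gI m : \sum_k invmx (metric f u) k m * metric f u k l = (m == l)%:R.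
  have := metric_frame Vu; rewrite -mulmxA -(invmx_metric Vu) => /matrixP/(_ l m).
  rewrite [RHS]mxE eq_sym => <-; rewrite mxE; apply: eq_bigr => k _.
  by rewrite mulrC metric_sym.
rewrite /christoffel; under eq_bigr do rewrite -mulrA mulr_suml mulr_sumr.
rewrite exchange_big /= (bigD1 l)//= [X in _ + X]big1 ?addr0; last first.
  move=> m /negPf ml; transitivity (2^-1 *
    ((\sum_k invmx (metric f u) k m * metric f u k l) *
    ('D_(evec R i) (fun v => metric f v j m) u
     + 'D_(evec R j) (fun v => metric f v i m) u
     - 'D_(evec R m) (fun v => metric f v i j) u))); last first.
    by rewrite gI ml mul0r mulr0.
  by rewrite mulr_suml mulr_sumr; apply: eq_bigr => k _; rewrite mulrAC.
transitivity (2^-1 *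
    ((\sum_k invmx (metric f u) k l * metric f u k l) *
    ('D_(evec R i) (fun v => metric f v j l) u
     + 'D_(evec R j) (fun v => metric f v i l) u
     - 'D_(evec R l) (fun v => metric f v i j) u))).
  by rewrite mulr_suml mulr_sumr; apply: eq_bigr => k _; rewrite mulrAC.
rewrite gI eqxx mul1r.
rewrite (derive_metric i j l Vu) (derive_metric j i l Vu) (derive_metric l i j Vu).
have koszul (S : 'I_3 -> 'I_3 -> 'rV[R]_7) (D : 'I_3 -> 'rV[R]_7) :
    (forall k l, S k l = S l k) ->
    2^-1 * (dot (S i j) (D l) + dot (D j) (S i l)
      + (dot (S j i) (D l) + dot (D i) (S j l))
      - (dot (S l i) (D j) + dot (D i) (S l j))) = dot (S i j) (D l).
  move=> SC; rewrite (SC j i) (SC l i) (SC l j) [dot (S i l) _]dotC.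
  by field.
exact: (koszul (fun k l => 'D_(evec R k) ('D_(evec R l) f) u)
  (fun k => 'D_(evec R k) f u) (fun k l => ddf_comm k l Vu)).
Qed.

Lemma dot_push_nabla X Y w u : V u -> differentiable Y u ->
  dot (push f (nabla f X Y) u) ('D_w f u) = dot ('D_(X u) (push f Y) u) ('D_w f u).
Proof.
move=> Vu dY; have df := f_diff Vu; rewrite (derive_basis w df) !dot_sumr.
apply: eq_bigr => l _; rewrite !dotZr; congr (_ * _).
rewrite (derive_push _ Vu dY).2 dotDl dot_suml.
have -> : push f (nabla f X Y) u = push f ('D_(X u) Y) u + push f (fun v => \row_k
    \sum_i \sum_j christoffel f u k i j * X u 0 i * Y u 0 j) u.
  rewrite /push -(deriveDr _ _ df); congr ('D_ _ f u); apply/rowP => k.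
  by rewrite !mxE derive_coord.
rewrite dotDl; congr (_ + _).
rewrite [push f _ u](derive_basis _ df) dot_suml.
have swap (c : 'I_3 -> 'I_3 -> 'I_3 -> R) (a b g : 'I_3 -> R) :
    \sum_k (\sum_i \sum_j c k i j * a i * b j) * g k =
    \sum_j \sum_i a i * b j * \sum_k c k i j * g k by rewrite !sum3; ring.
transitivity (\sum_k (\sum_i \sum_j christoffel f u k i j * X u 0 i * Y u 0 j)
    * metric f u k l).
  by apply: eq_bigr => k _; rewrite dotZl [in LHS]mxE [metric f u k l]mxE.
apply: etrans (swap _ _ _ _) _.
apply: eq_bigr => j _; rewrite dotZl.
rewrite (derive_basis _ (df_diff j Vu)) dot_suml mulr_sumr; apply: eq_bigr => i _.
by rewrite dotZl (metric_christoffel _ _ _ Vu) mulrA [Y u 0 j * _]mulrC.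
Qed.

Local Notation h := (hf f e).

Lemma sff_dotN X Y k u : V u ->
  dot (sff f X Y u) (N k u) = dot ('D_(X u) (push f Y) u) (N k u).
Proof.
move=> Vu; have drop c (a b d n : 'rV[R]_7) : dot b n = 0 -> dot d n = 0 ->
    dot (a - c *: b - d) n = dot a n.
  by move=> bn dn; rewrite !dotBl dotZl bn dn mulr0 !subr0.
exact: drop (dot_f_N k u) (dot_df_N _ k Vu).
Qed.

Lemma dot_sff_df X Y w u : V u -> differentiable Y u ->
  dot (sff f X Y u) ('D_w f u) = 0.
Proof.
move=> Vu dY; have drop c (a b d n : 'rV[R]_7) : dot b n = 0 -> dot d n = dot a n ->
    dot (a - c *: b - d) n = 0.
  by move=> bn dn; rewrite !dotBl dotZl bn dn mulr0 subr0 subrr.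
exact: drop (dot_f_df w Vu) (dot_push_nabla X w Vu dY).
Qed.

Lemma hfE i j k u : V u -> h i j k u = dot (DE i j u) (N k u).
Proof. exact: sff_dotN. Qed.

Lemma dot_E_derive_N i j k u : V u -> dot (E j u) ('D_(e i u) (N k) u) = - h i j k u.
Proof.
move=> Vu; rewrite (hfE _ _ _ Vu); apply/eqP; rewrite -eqr_oppLR; apply/eqP.
apply: esym; apply: (derive_dot_const _ Vu (E_diff j Vu) (N_diff k Vu)).
by move=> w Vw; exact: dot_df_N.
Qed.

Lemma sff_weingarten X Y k u : V u -> differentiable Y u ->
  dot (sff f X Y u) (N k u) = - dot (push f Y u) ('D_(X u) (N k) u).
Proof.
move=> Vu dY; apply: etrans (sff_dotN _ _ _ Vu) _.
have dpY : differentiable (push f Y) u by have [] := derive_push 0 Vu dY.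
have Y0 w : V w -> dot (push f Y w) (N k w) = 0 by move=> Vw; exact: dot_df_N.
exact: derive_dot_const Vu dpY (N_diff k Vu) Y0.
Qed.

Lemma sff_tensorial X Y k u : V u -> differentiable Y u ->
  dot (sff f X Y u) (N k u) = \sum_a \sum_b
    dot (push f X u) (E a u) * dot (push f Y u) (E b u) * h a b k u.
Proof.
move=> Vu dY; apply: etrans (sff_weingarten _ _ Vu dY) _.
have -> : 'D_(X u) (N k) u = \sum_a dot (push f X u) (E a u) *: 'D_(e a u) (N k) u.
  rewrite [in LHS](frame_expand (X u) Vu) (derive_sumr _ (N_diff k Vu)).
  by apply: eq_bigr => a _; exact: (deriveZr _ _ (N_diff k Vu)).
rewrite [X in dot X _](df_expand (Y u) Vu) dot_sumr -sumrN; apply: eq_bigr => a _.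
rewrite dotZr dot_suml mulr_sumr -sumrN; apply: eq_bigr => b _.
have alg (c c' r t : R) : r = - t -> - (c * (c' * r)) = c * c' * t by move=> ->; ring.
by rewrite dotZl; exact: alg (dot_E_derive_N a b k Vu).
Qed.

Lemma h_diff i j k u : V u -> differentiable (h i j k) u.
Proof.
move=> Vu; apply: (eqV_diff Vu (fun w Vw => esym (hfE i j k Vw))).
by have [] := derive_dot 0 (DE_diff i j Vu) (N_diff k Vu).
Qed.

Lemma h_sym12 i j k u : V u -> h j i k u = h i j k u.
Proof.
move=> Vu; have B := derive_bracket (f_diff_near Vu) (fun m => df_diff m Vu)
  (e_diff i Vu) (e_diff j Vu).
have alg (a b c n : 'rV[R]_7) : a - b = c -> dot c n = 0 -> dot b n = dot a n.
  by move=> <-; rewrite dotBl => H; lra.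
apply: etrans (hfE _ _ _ Vu) _; apply: etrans _ (esym (hfE _ _ _ Vu)).
exact: alg B (dot_df_N _ _ Vu).
Qed.

Lemma h_swap i j k u : V u ->
  h i k j u = h i j k u + dot (E j u) (cross (E i u) (E k u)).
Proof.
move=> Vu; have D := dot_E_derive_N i j k Vu.
have alg (c d m x : 'rV[R]_7) (p q : R) : d = cross c m + cross (f u) x ->
    dot (E j u) d = - p -> q = dot x (N j u) -> q = p + dot (E j u) (cross c m).
  move=> -> + ->; rewrite dotDr -[dot _ (cross (f u) x)]dot_cross_cycle.
  by rewrite [cross (E j u) _]crossC dotNl [dot x _]dotC /Jop => H; lra.
exact: alg (derive_N k (e i u) Vu).2 D (hfE _ _ _ Vu).
Qed.

Lemma dot_E_cross_EE a b c u : V u -> dot (E a u) (cross (E b u) (E c u)) = 0.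
Proof.
move=> Vu; apply: (@swap_cyclic_eq0 _ (fun i j k => h i j k u)
  (fun a b c => dot (E a u) (cross (E b u) (E c u)))).
- by move=> i j k; exact: h_sym12.
- by move=> i j k; exact: h_swap.
- by move=> i j k; rewrite -[RHS]dot_cross_cycle; exact: dotC.
Qed.

Lemma h_sym23 i j k u : V u -> h i k j u = h i j k u.
Proof. by move=> Vu; rewrite (h_swap i j k Vu) (dot_E_cross_EE _ _ _ Vu) addr0. Qed.

Lemma Gop_dotN X Y k u : V u -> differentiable Y u ->
  dot (Gop f X Y u) (N k u) = dot (cross (push f X u) (push f Y u)) (N k u).
Proof.
move=> Vu dY; have dpY : differentiable (push f Y) u by have [] := derive_push 0 Vu dY.
have dX := (derive_cross (X u) (f_diff Vu) dpY).2.
have drop c c' (F A D B0 n : 'rV[R]_7) : D = A + cross F B0 -> dot F n = 0 ->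
    dot (D - c *: F - cross F (B0 - c' *: F)) n = dot A n.
  move=> -> Fn; have crossB : cross F (B0 - c' *: F) = cross F B0.
    by rewrite addrC -scaleNr (cross_linearr F) crossvv scaler0 add0r.
  by rewrite crossB !dotBl dotDl dotZl Fn; ring.
exact: drop dX (dot_f_N k u).
Qed.

Local Notation w := (omegaf f e).

Lemma omegafE i j k u : V u -> w i j k u = dot (cross (E i u) (E j u)) (N k u).
Proof. by move=> Vu; exact: Gop_dotN (e_diff j Vu). Qed.

Lemma dot_cross_EE i j x u : V u ->
  dot (cross (E i u) (E j u)) x = \sum_k w i j k u * dot x (N k u).
Proof.
move=> Vu; apply: etrans (parsevalV _ x Vu) _.
have D k : dot (cross (E i u) (E j u)) (E k u) = 0.
  by apply: etrans (dotC _ _) _; exact: dot_E_cross_EE.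
have F : dot (cross (E i u) (E j u)) (f u) = 0.
  rewrite dot_cross_cycle crossC dotC dotNl -[X in - X = _]/(dot (N j u) (E i u)).
  by rewrite [dot _ _]dotC (dot_df_N _ j Vu : dot (E i u) (N j u) = 0) oppr0.
rewrite F mul0r add0r big1 ?add0r; last by move=> k _; rewrite D mul0r.
by apply: eq_bigr => k _; congr (_ * _); exact: esym (omegafE _ _ _ Vu).
Qed.

Lemma volume_form_omega u : V u -> volume_form (fun i j k => w i j k u).
Proof.
move=> Vu; have w1 i j k : w j i k u = - w i j k u.
  apply: etrans (omegafE _ _ _ Vu) _; apply: etrans _ (congr1 _ (esym (omegafE _ _ _ Vu))).
  exact: etrans (congr1 (fun z => dot z _) (crossC _ _)) (dotNl _ _).
have w2 i j k : w i k j u = - w i j k u.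
  apply: etrans (omegafE _ _ _ Vu) _; apply: etrans _ (congr1 _ (esym (omegafE _ _ _ Vu))).
  apply: dot_cross_skew; [|exact: dot_f_df..].
  by apply: etrans (dotC _ _) _; exact: dot_f_df.
set o0 : 'I_3 := inord 0; set o1 : 'I_3 := inord 1; set o2 : 'I_3 := inord 2.
have sq1 : \sum_k w o0 o1 k u * w o0 o1 k u = 1.
  have o01 : (o0 == o1) = false by rewrite -val_eqE /= !inordK.
  have E0 := eO Vu o0 o0; have E1 := eO Vu o1 o1; have E01 := eO Vu o0 o1.
  rewrite eqxx in E0; rewrite eqxx in E1; rewrite o01 in E01.
  apply: etrans (etrans (dot_cross_unit _ E0 E01) E1).
  apply: etrans _ (esym (dot_cross_EE o0 o1 _ Vu)).
  by apply: eq_bigr => k _; congr (_ * _); exact: (omegafE o0 o1 k Vu).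
have z (x : R) : x = - x -> x = 0 by move=> ?; lra.
have w0 : w o0 o1 o0 u = 0 by apply: etrans (w1 o1 o0 o0) _; rewrite (z _ (w2 o1 o0 o0)) oppr0.
have alg (F : 'I_3 -> R) : \sum_k F k * F k = 1 -> F o0 = 0 -> F o1 = 0 -> 0 < F o2 -> F o2 = 1.
  rewrite sum3 => + F0 F1 F2; rewrite F0 F1 !mul0r !add0r -expr2 => /eqP.
  by rewrite sqrf_eq1 => /orP[/eqP//|/eqP FN]; move: F2; rewrite FN ltr0N1.
split; [exact: w1 | exact: w2 |].
exact: (alg (fun k => w o0 o1 k u) sq1 w0 (z _ (w2 o0 o1 o1)) (eP Vu)).
Qed.

Lemma h_trace l u : V u -> \sum_i h l i i u = 0.
Proof.
move=> Vu; apply: (@cubic_trace _ _ (fun i j k => h i j k u) (volume_form_omega Vu)).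
- by move=> i j k; exact: h_sym12.
- by move=> i j k; exact: h_sym23.
move=> m i j k.
have sE a b c : \sum_n w a b n u * h m c n u
    = dot (cross (E a u) (E b u)) ('D_(e m u) (E c) u).
  apply: etrans _ (esym (dot_cross_EE a b _ Vu)).
  by apply: eq_bigr => n _; congr (_ * _); exact: hfE.
have C := derive_cross (e m u) (E_diff i Vu) (E_diff j Vu).
have Z v : V v -> dot (cross (E i v) (E j v)) (E k v) = 0.
  by move=> Vv; apply: etrans (dotC _ _) _; exact: dot_E_cross_EE.
have := derive_dot_const (e m u) Vu C.1 (E_diff k Vu) Z.
have alg (x c : 'rV[R]_7) (x' : 'rV[R]_7) (s1 s2 s3 t1 t2 t3 : R) : x = x' ->
    dot x' c = t1 + t2 -> s1 = t1 -> s2 = t2 -> s3 = t3 -> dot x c = - t3 ->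
    s1 + s2 + s3 = 0.
  by move=> -> -> -> -> -> ->; rewrite addNr.
exact: alg C.2 (dot_crossD_cycle _ _ _ _ _) (sE _ _ _) (sE _ _ _) (sE _ _ _).
Qed.

(* The connection coefficients <D_(e_l) E_i, E_a>. *)
Local Notation G l i a u := (dot ('D_(e l u) (E i) u) (E a u)).

Lemma G_skew l i j u : V u -> G l j i u = - G l i j u.
Proof.
move=> Vu; have C v : V v -> dot (E j v) (E i v) = (j == i)%:R by move=> Vv; exact: eO.
apply: etrans (derive_dot_const (e l u) Vu (E_diff j Vu) (E_diff i Vu) C) _.
exact: (congr1 -%R (dotC _ _)).
Qed.

Lemma dot_N_derive_N l k m u : V u ->
  dot (N m u) ('D_(e l u) (N k) u) = w l k m u + G l k m u.
Proof.
move=> Vu; have alg (x a b c d : 'rV[R]_7) (p : R) : x = a + b -> p = dot a c ->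
    dot c b = dot d (E m u) -> dot c x = p + dot d (E m u).
  by move=> -> -> <-; rewrite dotDr [dot c a]dotC.
apply: alg (derive_N k _ Vu).2 (omegafE _ _ _ Vu) _.
by apply: etrans (dot_cross_unit _ (ff1 Vu) (dot_f_df _ Vu)) _; exact: dotC.
Qed.

Lemma dot_f_derive_N l k u : V u -> dot (f u) ('D_(e l u) (N k) u) = 0.
Proof.
move=> Vu; have C v : V v -> dot (f v) (N k v) = 0 by move=> _; exact: dot_f_N.
have := derive_dot_const (e l u) Vu (f_diff Vu) (N_diff k Vu) C.
have alg (p q : R) : p = 0 -> p = - q -> q = 0 by move=> p0 pq; lra.
exact: alg (dot_df_N _ k Vu).
Qed.

Lemma dot_derive_N l k x u : V u -> dot x ('D_(e l u) (N k) u) =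
  \sum_m dot x (N m u) * (w l k m u + G l k m u) - \sum_a dot x (E a u) * h l a k u.
Proof.
move=> Vu; apply: etrans (parsevalV _ _ Vu) _.
have alg (p q r s t t' : R) : q = 0 -> t = t' -> s = - r -> p * q + s + t = t' - r.
  by move=> -> -> ->; rewrite mulr0 add0r addrC.
apply: alg.
- by apply: etrans (dotC _ _) _; exact: dot_f_derive_N.
- apply: eq_bigr => m _; congr (_ * _).
  by apply: etrans (dotC _ _) _; exact: dot_N_derive_N.
- rewrite -sumrN; apply: eq_bigr => a _; rewrite -mulrN; congr (_ * _).
  by apply: etrans (dotC _ _) _; exact: dot_E_derive_N.
Qed.

Lemma nabla_frame X Y u : V u -> differentiable Y u -> nabla f X Y u =
  \sum_a dot ('D_(X u) (push f Y) u) (E a u) *: e a u.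
Proof.
move=> Vu dY; apply: etrans (frame_expand _ Vu) _; apply: eq_bigr => a _.
exact: (congr1 (fun z => z *: _) (dot_push_nabla _ _ Vu dY)).
Qed.

Lemma frame_comb_diff (k : 'I_3 -> 'rV[R]_3 -> R) u : V u ->
  (forall a, differentiable (k a) u) ->
  differentiable (fun v => \sum_a k a v *: e a v) u.
Proof.
move=> Vu dk; rewrite (_ : (fun v => _) = \sum_a (fun v => k a v *: e a v)); last first.
  by apply/funext => v; rewrite fct_sumE.
apply: differentiable_sum => a.
by have [] := scale_leibniz 0 (dk a) (e_diff a Vu).
Qed.

Lemma nabla_diff i j u : V u -> differentiable (nabla f (e i) (e j)) u.
Proof.
move=> Vu; have nE v : V v -> \sum_a G i j a v *: e a v = nabla f (e i) (e j) v.
  by move=> Vv; exact: esym (nabla_frame _ Vv (e_diff j Vv)).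
apply: (eqV_diff Vu nE); apply: (frame_comb_diff Vu) => a.
by have [] := derive_dot 0 (DE_diff i j Vu) (E_diff a Vu).
Qed.

Lemma sff_diff i j u : V u -> differentiable (sff f (e i) (e j)) u.
Proof.
move=> Vu; have dD := DE_diff i j Vu; have df := f_diff Vu.
have dpn : differentiable (push f (nabla f (e i) (e j))) u.
  by have [] := derive_push 0 Vu (nabla_diff i j Vu).
have [dc _] := derive_dot 0 dD df.
have [ds _] := scale_leibniz 0 dc df.
exact: differentiableB (differentiableB dD ds) dpn.
Qed.

Local Notation d l i j k u := ('D_(e l u) (h i j k) u).

Lemma derive_sff_dotN l i j k u : V u ->
  dot ('D_(e l u) (sff f (e i) (e j)) u) (N k u) =
  d l i j k u - \sum_m h i j m u * (w l k m u + G l k m u).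
Proof.
move=> Vu; have [_ D] := derive_dot (e l u) (sff_diff i j Vu) (N_diff k Vu).
have S := dot_derive_N l k (sff f (e i) (e j) u) Vu.
have alg (p q r s t : R) : p = q + r -> r = s - t -> t = 0 -> q = p - s.
  by move=> -> -> ->; rewrite subr0 addrK.
apply: alg D S _; apply: big1 => a _.
apply: etrans (congr1 (fun z => z * _) _) (mul0r _).
exact: dot_sff_df Vu (e_diff j Vu).
Qed.

Lemma derive_sff_dotN_second l i j k u : V u ->
  dot ('D_(e l u) (sff f (e i) (e j)) u) (N k u) =
  dot ('D_(e l u) (DE i j) u) (N k u) - \sum_a G i j a u * h l a k u.
Proof.
move=> Vu; apply: etrans (derive_sff_dotN _ _ _ _ Vu) _.
have [_ D] := derive_dot (e l u) (DE_diff i j Vu) (N_diff k Vu).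
have D' : d l i j k u = 'D_(e l u) (fun v => dot (DE i j v) (N k v)) u.
  by apply: (eqV_derive _ Vu) => v Vv; exact: hfE.
have S := dot_derive_N l k (DE i j u) Vu.
have alg (p p' q r s s' t : R) : p' = p -> p = q + r -> r = s - t -> s' = s -> p' - s' = q - t.
  by move=> -> -> -> ->; rewrite addrA addrAC addrK.
apply: alg D' D S _; apply: eq_bigr => m _; congr (_ * _); exact: hfE.
Qed.

Lemma dot_derive_E_N v j k u : V u ->
  dot ('D_v (E j) u) (N k u) = \sum_a dot ('D_v f u) (E a u) * h a j k u.
Proof.
move=> Vu; have dE := E_diff j Vu.
have -> : 'D_v (E j) u = \sum_a dot ('D_v f u) (E a u) *: 'D_(e a u) (E j) u.
  rewrite [in LHS](frame_expand v Vu) (derive_sumr _ dE).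
  by apply: eq_bigr => a _; exact: deriveZr.
rewrite dot_suml; apply: eq_bigr => a _; rewrite dotZl; congr (_ * _).
exact: esym (hfE _ _ _ Vu).
Qed.

Lemma codazzi_sff l i j k u : V u ->
  dot ('D_(e l u) (sff f (e i) (e j)) u) (N k u) + \sum_a G i j a u * h l a k u
  - (dot ('D_(e i u) (sff f (e l) (e j)) u) (N k u) + \sum_a G l j a u * h i a k u)
  = \sum_a (G l i a u - G i l a u) * h a j k u.
Proof.
move=> Vu.
have nE : \forall v \near u, differentiable (E j) v.
  by apply: filterS (nearV Vu) => v; exact: E_diff.
have Bf := derive_bracket (f_diff_near Vu) (fun m => df_diff m Vu)
  (e_diff l Vu) (e_diff i Vu).
have BE := derive_bracket nE (fun m => dE_diff j m Vu) (e_diff l Vu) (e_diff i Vu).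
have alg (p p' s s' t : R) (a b c n : 'rV[R]_7) : p = dot a n - s ->
    p' = dot b n - s' -> a - b = c -> dot c n = t -> p + s - (p' + s') = t.
  by move=> -> -> <- <-; rewrite !subrK dotBl.
apply: alg (derive_sff_dotN_second _ _ _ _ Vu) (derive_sff_dotN_second _ _ _ _ Vu) BE _.
apply: etrans (dot_derive_E_N _ _ _ Vu) _; apply: eq_bigr => a _.
by apply: (congr1 (fun z => z * _)); apply: etrans (congr1 (fun z => dot z _) (esym Bf)) _;
  exact: dotBl.
Qed.

Lemma shape_frame i b u : V u ->
  Defs.shape f (N b) (e i) u = \sum_a h i a b u *: e a u.
Proof.
move=> Vu; refine (etrans (raise_index (fun l => dot (sff f (e i) (dcoord l) u) (N b u)) Vu) _).
apply: eq_bigr => a _; apply: (congr1 (fun z => z *: _)).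
have D l : dot (sff f (e i) (dcoord l) u) (N b u) =
    - dot ('D_(evec R l) f u) ('D_(e i u) (N b) u).
  by apply: (sff_weingarten _ _ Vu); exact: differentiable_cst.
transitivity (- dot (\sum_l e a u 0 l *: 'D_(evec R l) f u) ('D_(e i u) (N b) u)).
  rewrite dot_suml -sumrN; apply: eq_bigr => l _; rewrite dotZl -mulrN.
  exact: (congr1 (fun z => _ * z) (D l)).
apply: etrans (congr1 (fun z => - dot z _) (esym (derive_basis _ (f_diff Vu)))) _.
by apply: etrans (congr1 -%R (dot_E_derive_N _ _ _ Vu)) _; exact: opprK.
Qed.

Lemma push_comb (k : 'I_3 -> R) u : V u ->
  'D_(\sum_a k a *: e a u) f u = \sum_a k a *: E a u.
Proof.
move=> Vu; apply: etrans (derive_sumr _ (f_diff Vu)) _.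
by apply: eq_bigr => a _; exact: (deriveZr _ _ (f_diff Vu)).
Qed.

Lemma Gop_shape_dotN l i j k u : V u ->
  dot (Gop f (e l) (Defs.shape f (N j) (e i)) u) (N k u) = \sum_a h i a j u * w l a k u.
Proof.
move=> Vu; have dS : differentiable (Defs.shape f (N j) (e i)) u.
  apply: (eqV_diff Vu (fun v Vv => esym (shape_frame i j Vv))).
  by apply: (frame_comb_diff Vu) => a; exact: h_diff.
apply: etrans (Gop_dotN _ _ Vu dS) _.
have pS : push f (Defs.shape f (N j) (e i)) u = \sum_a h i a j u *: E a u.
  by apply: etrans (push_comb _ Vu); exact: (congr1 (fun z => 'D_z f u) (shape_frame i j Vu)).
apply: etrans (congr1 (fun z => dot (cross (E l u) z) (N k u)) pS) _.
rewrite cross_sumZr dot_suml; apply: eq_bigr => a _; rewrite dotZl.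
exact: (congr1 (fun z => _ * z) (esym (omegafE _ _ _ Vu))).
Qed.

Lemma nablaperp_dotN X xi k u : V u ->
  dot (nablaperp f X xi u) (N k u) = dot ('D_(X u) xi u) (N k u).
Proof.
move=> Vu; have drop c (a b p n : 'rV[R]_7) : dot b n = 0 -> dot p n = 0 ->
    dot (a - c *: b - p) n = dot a n.
  by move=> bn pn; rewrite !dotBl dotZl bn pn mulr0 !subr0.
exact: drop (dot_f_N k u) (dot_df_N _ k Vu).
Qed.

Lemma sum_delta (F : 'I_3 -> R) i : \sum_a (i == a)%:R * F a = F i.
Proof.
rewrite (bigD1 i)//= eqxx mul1r big1 ?addr0// => a /negPf ai.
by rewrite eq_sym ai mul0r.
Qed.

Lemma sum_deltaM (F : 'I_3 -> R) i y : \sum_a (i == a)%:R * y * F a = y * F i.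
Proof. by under eq_bigr do rewrite -mulrA; rewrite (sum_delta (fun a => y * F a)). Qed.

Lemma dot_push_nabla_E l i a u : V u ->
  dot (push f (nabla f (e l) (e i)) u) (E a u) = G l i a u.
Proof. by move=> Vu; exact: dot_push_nabla (e_diff i Vu). Qed.

Lemma sff_nabla_l l i j k u : V u ->
  dot (sff f (nabla f (e l) (e i)) (e j) u) (N k u) = \sum_a G l i a u * h a j k u.
Proof.
move=> Vu; apply: etrans (sff_tensorial _ _ Vu (e_diff j Vu)) _.
apply: eq_bigr => a _.
apply: etrans _ (sum_deltaM (fun b => h a b k u) j (G l i a u)).
apply: eq_bigr => b _; apply: (congr1 (fun z => z * _)); apply: etrans (mulrC _ _) _.
by apply: f_equal2; [exact: eO | exact: dot_push_nabla_E].
Qed.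

Lemma sff_nabla_r l i j k u : V u ->
  dot (sff f (e i) (nabla f (e l) (e j)) u) (N k u) = \sum_a G l j a u * h i a k u.
Proof.
move=> Vu; apply: etrans (sff_tensorial _ _ Vu (nabla_diff l j Vu)) _.
apply: etrans (exchange_big _ _ _ _ _ _) _; apply: eq_bigr => b _.
apply: etrans _ (sum_deltaM (fun a => h a b k u) i (G l j b u)).
apply: eq_bigr => a _; apply: (congr1 (fun z => z * _)).
by apply: f_equal2; [exact: eO | exact: dot_push_nabla_E].
Qed.

Lemma TfE l i j k u : V u -> Tf f e l i j k u =
  d l i j k u - \sum_m h i j m u * (w l k m u + G l k m u)
  - \sum_a G l i a u * h a j k u - \sum_a G l j a u * h i a k u
  - 4^-1 * (\sum_a h i a j u * w l a k u + \sum_a h j a l u * w i a k u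
            + \sum_a h l a i u * w j a k u).
Proof.
move=> Vu; have alg (q : R) (np s1 s2 g1 g2 g3 n : 'rV[R]_7) (p t1 t2 r1 r2 r3 : R) :
    dot np n = p -> dot s1 n = t1 -> dot s2 n = t2 ->
    dot g1 n = r1 -> dot g2 n = r2 -> dot g3 n = r3 ->
    dot (np - s1 - s2 - q *: (g1 + g2 + g3)) n = p - t1 - t2 - q * (r1 + r2 + r3).
  by move=> <- <- <- <- <- <-; rewrite !dotBl dotZl !dotDl.
exact: alg (etrans (nablaperp_dotN _ _ k Vu) (derive_sff_dotN l i j k Vu))
  (sff_nabla_l l i j k Vu) (sff_nabla_r l i j k Vu) (Gop_shape_dotN l i j k Vu)
  (Gop_shape_dotN i j l k Vu) (Gop_shape_dotN j l i k Vu).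
Qed.

Lemma grad_sqnorm_frame (s : 'rV[R]_3 -> R) u : V u -> differentiable s u ->
  grad_sqnorm f s u = \sum_a ('D_(e a u) s u) ^+ 2.
Proof.
move=> Vu ds; have gE : grad f s u = \sum_a 'D_(e a u) s u *: e a u.
  refine (etrans (raise_index (fun l => 'D_(evec R l) s u) Vu) _).
  apply: eq_bigr => a _; apply: (congr1 (fun z => z *: _)).
  exact: esym (derive_basis _ ds).
have pE : push f (grad f s) u = \sum_a 'D_(e a u) s u *: E a u.
  by apply: etrans (push_comb _ Vu); exact: (congr1 (fun z => 'D_z f u) gE).
apply: etrans (congr1 (fun z => dot z z) pE) _.
rewrite dot_suml; apply: eq_bigr => a _; rewrite dotZl dot_sumr expr2.
apply: (congr1 (fun z => _ * z)).
apply: etrans _ (sum_delta (fun b => 'D_(e b u) s u) a); apply: eq_bigr => b _.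
by rewrite dotZr mulrC; exact: (congr1 (fun z => z * _) (eO Vu a b)).
Qed.

Lemma derive_h_sqnorm v u : V u -> differentiable (h_sqnorm f e) u /\
  'D_v (h_sqnorm f e) u =
    2 * \sum_i \sum_j \sum_k h i j k u * 'D_v (h i j k) u.
Proof.
move=> Vu; have q i j k := derive_sqr v (h_diff i j k Vu).
have q1 i j := derive_sum_fun v (fun k => (q i j k).1).
have q2 i := derive_sum_fun v (fun j => (q1 i j).1).
have q3 := derive_sum_fun v (fun i => (q2 i).1).
split; first exact: q3.1.
apply: etrans q3.2 _; rewrite mulr_sumr; apply: eq_bigr => i _.
apply: etrans (q2 i).2 _; rewrite mulr_sumr; apply: eq_bigr => j _.
apply: etrans (q1 i j).2 _; rewrite mulr_sumr; apply: eq_bigr => k _.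
exact: (q i j k).2.
Qed.

Lemma pointwise_inequality u : V u ->
  9 / 40 * grad_sqnorm f (h_sqnorm f e) u - 1 / 3 * A_sqnorm f e u <=
  P_sqnorm f e u + 3 * (\sum_i \sum_j \sum_k Pf f e i j k u * Pf f e j i k u).
Proof.
move=> Vu.
have -> : grad_sqnorm f (h_sqnorm f e) u =
    \sum_l (2 * \sum_i \sum_j \sum_k h i j k u * d l i j k u) ^+ 2.
  apply: etrans (grad_sqnorm_frame Vu (derive_h_sqnorm 0 Vu).1) _.
  by apply: eq_bigr => l _; apply: (congr1 (fun z => z ^+ 2)); exact: (derive_h_sqnorm _ Vu).2.
apply: (@contracted_T_inequality R (fun i j k => w i j k u) (fun i j k => h i j k u)
  (fun l i a => G l i a u) (fun l i j k => d l i j k u) (fun l i j k => Tf f e l i j k u)).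
- exact: volume_form_omega.
- by move=> i j k; exact: h_sym12.
- by move=> i j k; exact: h_sym23.
- move=> k; apply: etrans (h_trace k Vu); apply: eq_bigr => i _.
  by apply: etrans (esym (h_sym23 _ _ _ Vu)) _; exact: esym (h_sym12 _ _ _ Vu).
- by move=> l i j k; apply: (eqV_derive _ Vu) => v Vv; exact: h_sym12.
- by move=> l i j k; apply: (eqV_derive _ Vu) => v Vv; exact: h_sym23.
- move=> l k; have [_ D] := derive_sum_fun (e l u) (fun i => h_diff i i k Vu).
  apply: etrans (esym D) _; apply: etrans (derive_cst (0 : R) u (e l u)).
  apply: (eqV_derive _ Vu) => v Vv; apply: etrans (h_trace k Vv); apply: eq_bigr => i _.
  by apply: etrans (esym (h_sym23 _ _ _ Vv)) _; exact: esym (h_sym12 _ _ _ Vv).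
- by move=> l i j; exact: G_skew.
- move=> l i j k; have alg (p p' q q' s s' r r' t : R) :
      q = p -> q' = p' -> q + s - (q' + s') = t ->
      t = r - r' -> p - r - s' = p' - r' - s.
    by move=> <- <- ? ?; lra.
  have C := codazzi_sff l i j k Vu.
  have t : \sum_a (G l i a u - G i l a u) * h a j k u =
      \sum_a G l i a u * h a j k u - \sum_a G i l a u * h a j k u.
    by apply: etrans _ (sumrB _ _ _ _); apply: eq_bigr => a _; exact: mulrBl.
  exact: (alg _ _ _ _ _ _ _ _ _ (derive_sff_dotN l i j k Vu) (derive_sff_dotN i l j k Vu) C t).
- by move=> l i j k; exact: TfE.
Qed.

End Geometry.

(* At the point p of M, with the tensors computed in an arbitrary chart c around
   p and an arbitrary local oriented orthonormal frame e near p. *)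
Theorem lemma3p2 (R : realType) (M : topologicalType) (atlas : set (chart R M))
    (hM : smooth_manifold atlas)
    (F : M -> 'rV[R]_7) (hF : lagrangian_immersion atlas F)
    (p : M) (c : chart R M) (hc : atlas c) (hp : chart_dom c p)
    (V : set 'rV[R]_3) (hVo : open V) (hVc : V `<=` chart_img c)
    (hVp : V (chart_map c p))
    (e : 'I_3 -> 'rV[R]_3 -> 'rV[R]_3)
    (he : oriented_orthonormal_frame (F \o chart_inv c) V e) :
  let f := F \o chart_inv c in
  let x := chart_map c p in
  P_sqnorm f e x + 3 * (\sum_i \sum_j \sum_k Pf f e i j k x * Pf f e j i k x)
    >= 9 / 40 * grad_sqnorm f (h_sqnorm f e) x - 1 / 3 * A_sqnorm f e x.
Proof.
cbv zeta; set f := F \o chart_inv c; set x := chart_map c p.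
have imgV u : V u -> chart_img c u by exact: hVc.
have [fS _] := lagrangian_immersed hF hc; have [eS eO eP] := he.
have lag u v v' : V u -> dot (cross (f u) ('D_v f u)) ('D_v' f u) = 0.
  move=> Vu; have E := lagrangian_normal hF hc (imgV u Vu).
  have : [set cross (f u) ('D_v f u) | v in setT] (cross (f u) ('D_v f u)) by exists v.
  by rewrite E => -[_]; apply.
apply: (@pointwise_inequality R V f e hVo _ _ lag eS eO eP x hVp).
- by move=> s u Vu; exact: fS (imgV u Vu).
- by move=> u _; exact: lagrangian_sphere hF _.
Qed.
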